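(* Let $X$ be a Banach space and $E$ a subspace of $X$. Consider the statements (i) $E^*$ has the Gaussian average property $\mathrm{GAP}$. (ii) There exists a constant $K\ge 0$ so that every $T\in\Pi_1(E,\ell_2)$ admits an extension $\widetilde{T}\in\Pi_1(X,\ell_2)$ with $\pi_1(\widetilde{T})\le K\pi_1(T)$. If $X$ is of finite cotype, then (i) implies (ii). If $X^*$ has $\mathrm{GAP}$, then (ii) implies (i).
   Context: Subspaces are closed linear subspaces. $\Pi_1(X,Y)$ is the space of 1-summing operators from $X$ to $Y$ with 1-summing norm $\pi_1$. For a Banach space $Z$, $\ell_2\otimes Z$ is identified with the finite rank operators from $\ell_2$ to $Z$. $(g_n)$ is a sequence of independent standard Gaussian variables on a probability space $(\Omega,\mathcal{S},\mu)$ and $(e_n)$ is the unit vector basis of $\ell_2$. For $T\in \ell_2\otimes Z$ the $\ell$-norm is $\ell(T)=\left(\int\|\sum_{n=1}^\infty g_n(t)Te_n\|^2d\mu(t)\right)^{1/2}$ (the series converges in $L_2(\mu,Z)$). $Z$ has $\mathrm{GAP}$ if there is a constant $K$ so that $\ell(T)\le K\pi_1(T^* )$ for all $T\in\ell_2\otimes Z$. *)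

(* Defs.v *)
From HB Require Import structures.
From mathcomp Require Import all_boot all_order all_algebra finmap.
From mathcomp Require Import all_classical all_reals all_analysis.
From mathcomp Require Import ring lra.

Set Implicit Arguments.
Unset Strict Implicit.
Unset Printing Implicit Defensive.

Import Order.TTheory GRing.Theory Num.Theory.
Import numFieldNormedType.Exports.

Local Open Scope classical_set_scope.
Local Open Scope ring_scope.

Section BoundedOperators.
Context {R : realType} {V W : normedModType R}.

Definition clinear : {pred V -> W} :=
  mem [set f : V -> W | linear f /\ continuous f].
Definition clinear_key : pred_key clinear. Proof. exact. Qed.
Canonical clinear_keyed := KeyedPred clinear_key.

Lemma clinearP (f : V -> W) : f \in clinear <-> linear f /\ continuous f.
Proof. by split; rewrite ?inE. Qed.

Lemma clinear_submod_closed : submod_closed clinear.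
Proof.
split=> [|a f g].
  apply/clinearP; split; last exact: cst_continuous.
  by move=> b x y; rewrite scaler0 addr0.
move=> /clinearP[lf cf] /clinearP[lg cg]; apply/clinearP; split.
  move=> b x y; rewrite -[LHS]/(a *: f (b *: x + y) + g (b *: x + y)).
  rewrite -[RHS]/(b *: (a *: f x + g x) + (a *: f y + g y)) lf lg !scalerDr.
  by rewrite !scalerA (mulrC a b) addrACA.
move=> x; apply: cvgD; last exact: cg.
by apply: cvgZl_tmp; exact: cf.
Qed.

HB.instance Definition _ :=
  GRing.isSubmodClosed.Build _ _ clinear clinear_submod_closed.

Record bounded_op : Type := BoundedOp {
  bop_fun :> V -> W;
  bop_clinear : bop_fun \in clinear }.

HB.instance Definition _ := [isSub for bop_fun].
HB.instance Definition _ := gen_eqMixin bounded_op.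
HB.instance Definition _ := gen_choiceMixin bounded_op.
HB.instance Definition _ := [SubChoice_isSubLmodule of bounded_op by <:].

Implicit Types T : bounded_op.

Lemma bop_linear T : linear T.
Proof. by have /clinearP[] := bop_clinear T. Qed.

Lemma bop_continuous T : continuous (T : V -> W).
Proof. by have /clinearP[] := bop_clinear T. Qed.

HB.instance Definition _ T :=
  GRing.isLinear.Build R V W *:%R (bop_fun T) (bop_linear T).

Definition opnorm T : R := sup [set `|T x| | x in [set x : V | `|x| <= 1]].

Lemma has_sup_opnorm T : has_sup [set `|T x| | x in [set x : V | `|x| <= 1]].
Proof.
split; first by exists `|T 0|, 0 => //=; rewrite normr0.
have : bounded_near T (nbhs (0 : V)).
  by apply: continuous_linear_bounded; exact: bop_continuous.
move=> /linear_boundedP /pinfty_ex_gt0[M M0 HM].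
exists M => _ [x /= x1 <-]; rewrite (le_trans (HM x))//.
by rewrite -[leRHS]mulr1 ler_pM2l.
Qed.

Lemma opnorm_ge0 T : 0 <= opnorm T.
Proof.
apply: (@le_trans _ _ `|T 0|) => //.
by apply: ub_le_sup; [exact: (has_sup_opnorm T).2|exists 0 => //=; rewrite normr0].
Qed.

Lemma ler_opnorm T x : `|T x| <= opnorm T * `|x|.
Proof.
have [->|x0] := eqVneq x 0; first by rewrite linear0 !normr0 mulr0.
have nx0 : 0 < `|x| by rewrite normr_gt0.
rewrite -ler_pdivrMr//.
apply: ub_le_sup; first exact: (has_sup_opnorm T).2.
exists (`|x|^-1 *: x) => /=.
  by rewrite normrZ normfV normr_id mulVf ?gt_eqF.
by rewrite linearZ/= normrZ normfV normr_id mulrC.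
Qed.

Lemma opnorm_le T M : (forall x, `|x| <= 1 -> `|T x| <= M) -> opnorm T <= M.
Proof.
move=> TM; apply: ge_sup; first exact: (has_sup_opnorm T).1.
by move=> _ [x /= /TM ? <-].
Qed.

Lemma ler_opnormD T1 T2 : opnorm (T1 + T2) <= opnorm T1 + opnorm T2.
Proof.
apply: opnorm_le => x x1; rewrite (le_trans (ler_normD _ _))//.
by apply: lerD; apply: (le_trans (ler_opnorm _ _));
  rewrite ler_piMr ?opnorm_ge0.
Qed.

Lemma opnormZ a T : opnorm (a *: T) = `|a| * opnorm T.
Proof.
have le b S : opnorm (b *: S) <= `|b| * opnorm S.
  apply: opnorm_le => x x1; rewrite -[_ x]/(b *: S x) normrZ ler_wpM2l//.
  by rewrite (le_trans (ler_opnorm _ _))// ler_piMr ?opnorm_ge0.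
apply/eqP; rewrite eq_le le /=.
have [->|a0] := eqVneq a 0; first by rewrite normr0 mul0r opnorm_ge0.
rewrite mulrC -ler_pdivlMr ?normr_gt0// mulrC -normfV.
by apply: le_trans (le _ _); rewrite scalerA mulVf// scale1r.
Qed.

Lemma opnorm0_eq0 T : opnorm T = 0 -> T = 0.
Proof.
move=> T0; apply/val_inj/funext => x /=; apply/eqP.
by have := ler_opnorm T x; rewrite T0 mul0r normr_le0.
Qed.

HB.instance Definition _ :=
  @Lmodule_isNormed.Build R bounded_op opnorm ler_opnormD opnormZ opnorm0_eq0.

End BoundedOperators.
Arguments bounded_op {R} V W.

Section Completeness.
Context {R : realType} {V : normedModType R} {W : completeNormedModType R}.

Lemma bounded_op_complete (F : set_system (bounded_op V W)) :
  ProperFilter F -> cauchy F -> cvg F.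
Proof.
move=> FF /cauchyP Fc.
have Fe (e : R) : 0 < e ->
    exists T0 : bounded_op V W, F [set T : bounded_op V W | `|T0 - T| < e].
  by move=> /Fc[T0]; exists T0.
have Fcvg x : cvg ((fun T : bounded_op V W => T x) @ F).
  apply/cauchy_cvgP; apply: cauchy_exP => e e0.
  have d0 : 0 < e / (1 + `|x|) by rewrite divr_gt0// ltr_pwDl.
  have [T0 FT0] := Fe _ d0; exists (T0 x).
  change (\forall T \near F, ball (T0 x) e ((T : bounded_op V W) x)).
  apply: filterS FT0 => T /= T0T; rewrite -ball_normE /=.
  rewrite -[_ - _]/((T0 - T) x) (le_lt_trans (ler_opnorm _ _))//.
  have [->|x0] := eqVneq x 0; first by rewrite normr0 mulr0.
  rewrite -ltr_pdivlMr ?normr_gt0// (lt_le_trans T0T)//.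
  by rewrite ler_pM2l// lef_pV2 ?posrE ?normr_gt0// ?ltr_pwDl// lerDr.
pose g x := lim ((fun T : bounded_op V W => T x) @ F).
have Fg x : (fun T : bounded_op V W => T x) @ F --> g x by exact: Fcvg.
have lg : linear g.
  move=> a x y; apply/esym/(cvg_unique (@norm_hausdorff _ W) _ (Fg (a *: x + y))).
  rewrite (_ : (fun T : bounded_op V W => _) =
    (fun T : bounded_op V W => a *: T x + T y)); last first.
    by apply/funext => T; rewrite bop_linear.
  by apply: cvgD; [apply: cvgZl_tmp|]; exact: Fg.
have gdist (e : R) : 0 < e ->
    \forall T \near F, forall x, `|(T : bounded_op V W) x - g x| <= e * `|x|.
  move=> e0; have [T0 FT0] := Fe _ (divr_gt0 e0 (ltr0n _ 2)).
  apply: filterS (FT0) => T /= T0T x; apply/ler_addgt0Pr => d d0.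
  have /cvgrPdist_lt/(_ _ d0) Fd := Fg x.
  have [S [/= T0S gS]] := filter_ex (filterI FT0 Fd).
  have -> : T x - g x = ((T - T0) x + (T0 - S) x) - (g x - S x).
    rewrite -[(T - T0) x]/(T x - T0 x) -[(T0 - S) x]/(T0 x - S x).
    by rewrite addrA subrK opprB addrA subrK.
  apply: (le_trans (ler_normB _ _)); apply: lerD; last exact: ltW.
  rewrite (le_trans (ler_normD _ _))// (splitr e) mulrDl.
  apply: lerD; apply: (le_trans (ler_opnorm _ _)); apply: ler_wpM2r => //.
    by apply: ltW; move: T0T; rewrite -normrN opprB.
  exact: ltW.
have cg : continuous g.
  pose lgM := GRing.isLinear.Build R V W *:%R g lg.
  pose gl : {linear V -> W} := HB.pack g lgM.
  apply: (@bounded_linear_continuous _ _ _ gl).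
  apply/bounded_funP => r.
  have [T HT] := filter_ex (gdist 1 ltr01).
  exists ((opnorm T + 1) * r) => x xr.
  have -> : gl x = T x - (T x - g x) by rewrite subKr.
  rewrite (le_trans (ler_normB _ _))// mulrDl lerD//.
    rewrite (le_trans (ler_opnorm _ _))// ler_wpM2l ?opnorm_ge0//.
  by rewrite (le_trans (HT x))// ler_wpM2l.
have gP : g \in clinear by apply/clinearP.
apply/cvg_ex; exists (BoundedOp gP).
apply/cvgrPdist_le => e e0; apply: filterS (gdist e e0) => T HT.
rewrite -normrN opprB; apply: opnorm_le => x x1.
by rewrite (le_trans (HT x))// ler_piMr// ltW.
Qed.

HB.instance Definition _ :=
  Uniform_isComplete.Build (bounded_op V W) bounded_op_complete.

End Completeness.

(* R^o carries the normed space structure of the real line over itself; the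
   canonical norm `|phi| of phi : dual V is opnorm phi *)
Notation dual V := (bounded_op V (GRing.regular _)).

Section Ell2.
Context {R : realType}.

Definition square_summable : {pred nat -> R} :=
  mem [set u : nat -> R | cvgn (series (fun k => u k ^+ 2))].
Definition square_summable_key : pred_key square_summable. Proof. exact. Qed.
Canonical square_summable_keyed := KeyedPred square_summable_key.

Lemma square_summableP (u : nat -> R) :
  u \in square_summable <-> cvgn (series (fun k => u k ^+ 2)).
Proof. by split; rewrite ?inE. Qed.

Lemma square_summable_scaleD (a : R) (u v : nat -> R) :
  cvgn (series (fun k => u k ^+ 2)) -> cvgn (series (fun k => v k ^+ 2)) ->
  cvgn (series (fun k => (a * u k + v k) ^+ 2)).
Proof.
move=> su sv.
apply: (@series_le_cvg _ _ (fun k => 2 * a ^+ 2 * u k ^+ 2 + 2 * v k ^+ 2)).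
- by move=> k; exact: sqr_ge0.
- by move=> k; have := sqr_ge0 (a * u k); have := sqr_ge0 (v k); nra.
- by move=> k; have := sqr_ge0 (a * u k - v k); nra.
rewrite (_ : series _ = (2 * a ^+ 2) *: series (fun k => u k ^+ 2) +
  2 *: series (fun k => v k ^+ 2)); last first.
  by apply/funext => n; rewrite /series/= big_split/= -!mulr_sumr.
by apply: is_cvgD; exact: is_cvgZl_tmp.
Qed.

Lemma square_summable_submod_closed : submod_closed square_summable.
Proof.
split=> [|a u v].
  apply/square_summableP.
  rewrite (_ : series _ = fun=> 0); first exact: is_cvg_cst.
  by apply/funext => n; rewrite /series/= big1// => k _; rewrite expr0n.
move=> /square_summableP su /square_summableP sv; apply/square_summableP.
exact: square_summable_scaleD.
Qed.

HB.instance Definition _ :=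
  GRing.isSubmodClosed.Build _ _ square_summable square_summable_submod_closed.

Record ell2 : Type := Ell2 {
  ell2_fun :> nat -> R;
  ell2_square_summable : ell2_fun \in square_summable }.

HB.instance Definition _ := [isSub for ell2_fun].
HB.instance Definition _ := gen_eqMixin ell2.
HB.instance Definition _ := gen_choiceMixin ell2.
HB.instance Definition _ := [SubChoice_isSubLmodule of ell2 by <:].

Implicit Types u v : ell2.

Definition ell2_sqnorm u : R := limn (series (fun k => u k ^+ 2)).
Definition ell2_norm u : R := Num.sqrt (ell2_sqnorm u).

Lemma ell2_is_cvg u : cvgn (series (fun k => u k ^+ 2)).
Proof. exact/square_summableP/ell2_square_summable. Qed.

Lemma series_sqr_nd (u : nat -> R) :
  nondecreasing_seq (series (fun k => u k ^+ 2)).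
Proof. by apply: nondecreasing_series => k _ _; exact: sqr_ge0. Qed.

Lemma ell2_sqnorm_ge u n : series (fun k => u k ^+ 2) n <= ell2_sqnorm u.
Proof. exact: (nondecreasing_cvgn_le (@series_sqr_nd u) (@ell2_is_cvg u)). Qed.

Lemma ell2_sqnorm_ge0 u : 0 <= ell2_sqnorm u.
Proof. by apply: le_trans (ell2_sqnorm_ge u 0); rewrite /series/= big_geq. Qed.

Lemma ell2_coord_le u k : u k ^+ 2 <= ell2_sqnorm u.
Proof.
apply: le_trans (ell2_sqnorm_ge u k.+1).
by rewrite /series/= big_nat_recr//= lerDr sumr_ge0// => i _; exact: sqr_ge0.
Qed.

Lemma ell2_norm0_eq0 u : ell2_norm u = 0 -> u = 0.
Proof.
move=> /eqP; rewrite sqrtr_eq0 => u0; apply/val_inj/funext => k /=; apply/eqP.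
rewrite -[_ == _]/(u k == 0) -sqrf_eq0 eq_le sqr_ge0 andbT.
exact: le_trans (ell2_coord_le u k) u0.
Qed.

Lemma ell2_normZ (a : R) u : ell2_norm (a *: u) = `|a| * ell2_norm u.
Proof.
rewrite /ell2_norm -sqrtr_sqr -sqrtrM ?sqr_ge0//; congr Num.sqrt.
rewrite /ell2_sqnorm -[RHS](lim_seriesZ (a ^+ 2) (@ell2_is_cvg u)).
congr (limn (series _)); apply/funext => k.
exact: exprMn.
Qed.

Lemma ell2_normD u v : ell2_norm (u + v) <= ell2_norm u + ell2_norm v.
Proof.
have [/ell2_norm0_eq0 ->|u0] := eqVneq (ell2_norm u) 0.
  by rewrite add0r lerDr sqrtr_ge0.
have [/ell2_norm0_eq0 ->|v0] := eqVneq (ell2_norm v) 0.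
  by rewrite addr0 lerDl sqrtr_ge0.
have a0 : 0 < ell2_norm u by rewrite lt_def u0 sqrtr_ge0.
have b0 : 0 < ell2_norm v by rewrite lt_def v0 sqrtr_ge0.
have ua : ell2_norm u ^+ 2 = ell2_sqnorm u by rewrite sqr_sqrtr ?ell2_sqnorm_ge0.
have vb : ell2_norm v ^+ 2 = ell2_sqnorm v by rewrite sqr_sqrtr ?ell2_sqnorm_ge0.
set a := ell2_norm u in a0 ua *; set b := ell2_norm v in b0 vb *.
have ab0 : 0 <= a + b by rewrite addr_ge0// ltW.
suff : ell2_sqnorm (u + v) <= (a + b) ^+ 2.
  by move=> uv; rewrite -(ger0_norm ab0) -sqrtr_sqr; exact: ler_wsqrtr.
apply: limr_le; first exact: ell2_is_cvg.
apply: nearW => n.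
have -> : (a + b) ^+ 2 = (1 + b / a) * ell2_sqnorm u + (1 + a / b) * ell2_sqnorm v.
  by rewrite -ua -vb; field; rewrite !gt_eqF.
have c0 : 0 <= b / a by rewrite divr_ge0// ltW.
have d0 : 0 <= a / b by rewrite divr_ge0// ltW.
apply: (@le_trans _ _ ((1 + b / a) * series (fun k => u k ^+ 2) n +
    (1 + a / b) * series (fun k => v k ^+ 2) n)); last first.
  by apply: lerD; apply: ler_wpM2l; rewrite ?addr_ge0//; exact: ell2_sqnorm_ge.
rewrite /series/= !mulr_sumr -big_split/=; apply: ler_sum => k _.
rewrite [leLHS](_ : _ = (u k + v k) ^+ 2)//.
have -> : (1 + b / a) * u k ^+ 2 + (1 + a / b) * v k ^+ 2 =
  (u k + v k) ^+ 2 + (b * u k - a * v k) ^+ 2 / (a * b).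
  by field; rewrite !gt_eqF.
by rewrite lerDl divr_ge0 ?sqr_ge0// mulr_ge0// ltW.
Qed.

HB.instance Definition _ :=
  @Lmodule_isNormed.Build R ell2 ell2_norm ell2_normD ell2_normZ ell2_norm0_eq0.

Lemma delta_square_summable (n : nat) :
  (fun k : nat => (k == n)%:R : R) \in square_summable.
Proof.
apply/square_summableP.
apply/cvg_ex; exists 1; apply: cvg_near_cst.
exists n.+1 => // m /= nm.
rewrite /series/= big_mkord (bigD1 (Ordinal nm))//= eqxx expr1n big1 ?addr0//.
by move=> i /negPf; rewrite -val_eqE /= => ->; rewrite expr0n.
Qed.

Definition ell2_basis (n : nat) : ell2 := Ell2 (delta_square_summable n).
End Ell2.
Arguments ell2 R : clear implicits.

Section ClosedSubspace.
Context {R : realType} {X : normedModType R}.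

Record closed_subspace : Type := ClosedSubspace {
  subspace_set :> set X;
  subspace_submod : submod_closed (mem subspace_set);
  subspace_closed : closed subspace_set }.

Variable E : closed_subspace.

Definition subspace_pred : {pred X} := mem (subspace_set E).
Definition subspace_key : pred_key subspace_pred. Proof. exact. Qed.
Canonical subspace_keyed := KeyedPred subspace_key.

HB.instance Definition _ :=
  GRing.isSubmodClosed.Build _ _ subspace_pred (subspace_submod E).

Record subspace_type : Type := SubspaceElt {
  subspace_val :> X;
  subspace_valP : subspace_val \in subspace_pred }.

HB.instance Definition _ := [isSub for subspace_val].
HB.instance Definition _ := gen_eqMixin subspace_type.
HB.instance Definition _ := gen_choiceMixin subspace_type.
HB.instance Definition _ := [SubChoice_isSubLmodule of subspace_type by <:].

Definition subspace_norm (x : subspace_type) : R := `|subspace_val x|.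

Lemma subspace_normD x y :
  subspace_norm (x + y) <= subspace_norm x + subspace_norm y.
Proof. exact: ler_normD. Qed.

Lemma subspace_normZ (a : R) x :
  subspace_norm (a *: x) = `|a| * subspace_norm x.
Proof. exact: normrZ. Qed.

Lemma subspace_norm0_eq0 x : subspace_norm x = 0 -> x = 0.
Proof. by move=> /normr0_eq0 x0; exact/val_inj. Qed.

HB.instance Definition _ :=
  @Lmodule_isNormed.Build R subspace_type subspace_norm
    subspace_normD subspace_normZ subspace_norm0_eq0.

End ClosedSubspace.
Arguments closed_subspace {R} X.

Section Adjoint.
Context {R : realType} {V W : normedModType R}.
Variable T : bounded_op V W.

Lemma bop_comp_clinear (phi : dual W) :
  (fun x => phi (T x)) \in @clinear R V R^o.
Proof.
apply/clinearP; split; first by move=> a x y; rewrite !linearP.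
by move=> x; apply: continuous_comp; exact: bop_continuous.
Qed.

Definition adjoint_fun (phi : dual W) : dual V :=
  BoundedOp (bop_comp_clinear phi).

Lemma adjoint_clinear : adjoint_fun \in @clinear R (dual W) (dual V).
Proof.
have lT : linear adjoint_fun by move=> a phi psi; apply/val_inj/funext.
apply/clinearP; split=> //.
pose lTM := GRing.isLinear.Build R (dual W) (dual V) *:%R adjoint_fun lT.
pose Tl : {linear dual W -> dual V} := HB.pack adjoint_fun lTM.
apply: (@bounded_linear_continuous _ _ _ Tl); apply/bounded_funP => r.
exists (r * opnorm T) => phi phir; apply: opnorm_le => x x1.
apply: (le_trans (ler_opnorm phi (T x))); apply: ler_pM => //.
  exact: opnorm_ge0.
by rewrite (le_trans (ler_opnorm _ _))// ler_piMr// opnorm_ge0.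
Qed.

Definition adjoint : bounded_op (dual W) (dual V) := BoundedOp adjoint_clinear.
End Adjoint.

Section Summing.
Context {R : realType}.

(* The weak l1-norm of the finite family x *)
Definition weak_l1 {V : normedModType R} n (x : 'I_n -> V) : R :=
  sup [set \sum_(i < n) `|phi (x i)| | phi in [set phi : dual V | `|phi| <= 1]].

Definition summing_bound {V W : normedModType R} (T : bounded_op V W) (C : R) :=
  0 <= C /\ forall n (x : 'I_n -> V), \sum_(i < n) `|T (x i)| <= C * weak_l1 x.

Definition one_summing {V W : normedModType R} (T : bounded_op V W) :=
  exists C, summing_bound T C.

(* Equal to +oo when T is not 1-summing *)
Definition pi1 {V W : normedModType R} (T : bounded_op V W) : \bar R :=
  ereal_inf [set C%:E | C in [set C | summing_bound T C]].

Definition finite_rank {V W : normedModType R} (T : bounded_op V W) :=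
  exists (n : nat) (w : 'I_n -> W), forall x, exists c : 'I_n -> R,
    T x = \sum_(i < n) c i *: w i.

(* Cotype q for 2 <= q < oo; the average over the signs is the L2(0,1)-norm of
   the corresponding Rademacher sum *)
Definition cotype (X : normedModType R) (q : R) :=
  2 <= q /\ exists C : R, forall n (x : 'I_n -> X),
    (\sum_(i < n) `|x i| `^ q) `^ q^-1 <=
    C * Num.sqrt ((2 ^+ n)^-1 *
      \sum_(eps : {ffun 'I_n -> bool})
        `|\sum_(i < n) (-1) ^+ eps i *: x i| ^+ 2).

Definition finite_cotype (X : normedModType R) := exists q, cotype X q.
End Summing.

Section Gaussian.
Context {R : realType} d {Omega : measurableType d} (P : probability Omega R).

Definition independent_sequence (g : nat -> {RV P >-> R}) :=
  forall (J : {fset nat}) (B : nat -> set R), (forall j, measurable (B j)) ->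
    P (\bigcap_(j in [set` J]) (g j @^-1` B j)) =
    (\prod_(j <- J) P (g j @^-1` B j))%E.

Definition standard_gaussian (X : {RV P >-> R}) :=
  forall B : set R, measurable B -> distribution P X B = normal_prob 0 1 B.

Definition gaussian_sequence (g : nat -> {RV P >-> R}) :=
  independent_sequence g /\ forall n, standard_gaussian (g n).

Section BochnerL2.
Context {Z : normedModType R}.

Definition simple_function (s : Omega -> Z) :=
  finite_set (range s) /\ forall z, measurable (s @^-1` [set z]).

(* Strong measurability in the sense of Bochner *)
Definition strongly_measurable (S : Omega -> Z) :=
  exists s : nat -> Omega -> Z,
    (forall k, simple_function (s k)) /\
    forall t, (fun k => s k t) @ \oo --> S t.

Definition L2norm (S : Omega -> Z) : \bar R :=
  Lnorm P 2%:E (fun t => `|S t|%:E).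

Definition in_L2 (S : Omega -> Z) :=
  strongly_measurable S /\ (L2norm S < +oo)%E.

Definition L2_sum (f : nat -> Omega -> Z) (S : Omega -> Z) :=
  in_L2 S /\
  (fun N => L2norm (fun t => S t - \sum_(n < N) f n t)) @ \oo --> 0%E.
End BochnerL2.

Variable g : nat -> {RV P >-> R}.

(* The L2-norm of the sum in L2(P, Z) of the series of the g_n T(e_n); the sum
   is unique up to almost sure equality, so the choice made by xget is
   irrelevant *)
Definition ell_norm {Z : normedModType R} (T : bounded_op (ell2 R) Z) : \bar R :=
  L2norm (xget (cst 0) [set S | L2_sum (fun n t => g n t *: T (ell2_basis n)) S]).

(* adjoint T maps Z^* into (l2)^*, which is isometric to l2, so pi1 (adjoint T)
   is the 1-summing norm of T^* : Z^* -> l2 *)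
Definition GAP (Z : completeNormedModType R) :=
  exists K : R, forall T : bounded_op (ell2 R) Z, finite_rank T ->
    (ell_norm T <= K%:E * pi1 (adjoint T))%E.
End Gaussian.

Definition summing_extension {R : realType} {X : normedModType R}
    (E : closed_subspace X) :=
  exists K : R, 0 <= K /\
    forall T : bounded_op (subspace_type E) (ell2 R), one_summing T ->
      exists T' : bounded_op X (ell2 R),
        [/\ one_summing T', forall x : subspace_type E, T' (x : X) = T x &
            (pi1 T' <= K%:E * pi1 T)%E].

(* Main.v *)
(* Primes denote duals and adjoints.  For T : E -> l2 one has pi1(T'') <= pi1(T)
   (extend functionals), so GAP for E' bounds the L2-norm of the Gaussian sum of
   the T' e_i by K pi1(T).

   (i) => (ii).  With f_i = T' e_i, orthogonality of the g_i and Cauchy-Schwarz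
   turn the GAP bound on sum_i g_i f_i into
     c * sum_i f_i(w_i) <= K pi1(T) |sum_i g_i w_i|_{L2(E)}
   for finite sequences w in E, where c = E g_0^2.  By Hahn-Banach the f_i
   extend to phi_i in X' satisfying the same inequality for finite sequences w
   in X, and the extension of T is x |-> (phi_i(x))_i.  Its 1-summing norm is
   bounded by taking w_i = sum_k a_ki x_k with unit vectors a_k: then
   sum_i g_i w_i = sum_k G_k x_k with standard Gaussian (dependent) G_k, and
   the L2-norm of this sum is bounded by the weak l1-norm of (x_k) because, by
   Pisier's theorem, finite cotype dominates |sum_k a_k x_k| by a mu-average of
   exp(N |a_k|) for some finite measure mu on the indices.

   (ii) => (i).  T : l2 -> E' restricts to T0 : E -> l2 with
   pi1(T0) <= pi1(T'); extend T0 to X, apply GAP in X' to the adjoint of the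
   extension, and restrict the resulting Gaussian sums to E. *)
Require Import Defs.
From HB Require Import structures.
From mathcomp Require Import all_boot all_order all_algebra finmap.
From mathcomp Require Import all_classical all_reals all_analysis.
From mathcomp Require Import measurable_realfun.
From mathcomp Require Import ring lra.

Set Implicit Arguments.
Unset Strict Implicit.
Unset Printing Implicit Defensive.

Import Order.TTheory GRing.Theory Num.Theory.
Import numFieldNormedType.Exports.

Local Open Scope classical_set_scope.
Local Open Scope ring_scope.

(** * The Hahn-Banach theorem and 1-summing operators *)

(** The bound of (i) concerns all [f i] jointly, and extending each [f i] on its own would lose it;
    hence Hahn-Banach is applied once, to a single functional on a space of finite sequences. The
    variables [G_k] are dependent in an uncontrolled way, so the estimate to be integrated should be
    a sum over k of functions of one [|a_k|]; this is what the domination by [mu] provides.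
    Exponentials suit it twice: Gaussians have exponential moments, and exponential growth pays for
    cutting a coefficient vector into integer level sets, without interpolation theory. The passage
    to the second adjoint is a finite Hahn-Banach argument over sign patterns, in place of local
    reflexivity. [GAP] speaks of finite rank operators, so it is applied to truncations with bounds
    uniform in the number of coordinates, and l2-norms are recovered as limits of partial sums. *)

Section HahnBanach.
Context {R : realType} {V : lmodType R} (p : V -> R).
Hypothesis pD : forall x y, p (x + y) <= p x + p y.
Hypothesis pZ : forall (a : R) x, 0 <= a -> p (a *: x) = a * p x.

(** Partial functionals are encoded as linear relations, so that Zorn's lemma works with unions of
    sets; single-valuedness follows from domination by [p]. *)
Definition dominated_graph (G : set (V * R)) :=
  [/\ G (0, 0), forall a u w, G u -> G w -> G (a *: u.1 + w.1, a * u.2 + w.2) &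
      forall u, G u -> u.2 <= p u.1].

Lemma dominated_graph_uniq G x r s :
  dominated_graph G -> G (x, r) -> G (x, s) -> r = s.
Proof.
move=> [G0 GL Gp] Gr Gs.
have p0 : p 0 = 0 by rewrite -(scale0r (0 : V)) pZ// mul0r.
have le a b : G (x, a) -> G (x, b) -> a <= b.
  move=> Ga Gb; have := Gp _ (GL (-1) _ _ Gb Ga).
  by rewrite /= scaleN1r addNr p0; lra.
by apply/eqP; rewrite eq_le !le.
Qed.

Lemma dominated_graph_extend G v :
  dominated_graph G -> exists2 G', dominated_graph G' &
    G `<=` G' /\ exists r, G' (v, r).
Proof.
move=> [G0 GL Gp].
(* The value at [v] has to lie between all [u.2 - p (u.1 - v)] and all [p (w.1 + v) - w.2].
   Subadditivity separates the two families, and the supremum of the first is taken. *)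
pose A := [set u.2 - p (u.1 - v) | u in G].
have Aub w : G w -> ubound A (p (w.1 + v) - w.2).
  move=> Gw _ [u Gu <-].
  have := Gp _ (GL 1 _ _ Gu Gw); rewrite /= scale1r mul1r.
  have := pD (u.1 - v) (w.1 + v); rewrite addrACA (addrC (- v)) subrr addr0.
  by lra.
have supA : has_sup A.
  split; first by exists ((0 : R) - p (0 - v)), (0, 0).
  by exists (p (0 + v) - 0); exact: Aub G0.
pose c := sup A.
have cl u : G u -> u.2 - p (u.1 - v) <= c.
  by move=> Gu; apply: ub_le_sup; [exact: supA.2|exists u].
have cu w : G w -> c <= p (w.1 + v) - w.2.
  by move=> Gw; apply: ge_sup; [exact: supA.1|exact: Aub].
exists [set z | exists2 u, G u & exists t, z = (u.1 + t *: v, u.2 + t * c)].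
  split.
  - by exists (0, 0) => //; exists 0; rewrite /= scale0r mul0r !addr0.
  - move=> a _ _ [u Gu [t ->]] [w Gw [s ->]] /=.
    exists (a *: u.1 + w.1, a * u.2 + w.2); first exact: GL.
    exists (a * t + s) => /=; congr (_, _).
      by rewrite scalerDr scalerA addrACA scalerDl.
    by ring.
  - move=> _ [u Gu [t ->]] /=.
    have GZ a : G (a *: u.1, a * u.2).
      by have := GL a _ _ Gu G0; rewrite /= !addr0.
    (* Division by [|t|] reduces domination at [u.1 + t *: v] to the upper or the lower bound on
       [c]. *)
    have [t0|t0|->] := ltgtP t 0; last first.
    + by rewrite scale0r mul0r !addr0; exact: Gp.
    + have := cu _ (GZ t^-1).
      rewrite /= -(ler_pM2l t0) => le1.
      have -> : u.1 + t *: v = t *: (t^-1 *: u.1 + v).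
        by rewrite scalerDr scalerA divff ?gt_eqF// scale1r.
      rewrite (pZ _ (ltW t0)); move: le1; rewrite mulrBr mulrA divff ?gt_eqF// mul1r.
      by lra.
    + have nt0 : 0 < - t by rewrite oppr_gt0.
      have := cl _ (GZ (- t)^-1).
      rewrite /= -(ler_pM2l nt0) => le1.
      have -> : u.1 + t *: v = (- t) *: ((- t)^-1 *: u.1 - v).
        by rewrite scalerBr scalerA divff ?gt_eqF// scale1r scaleNr opprK.
      rewrite (pZ _ (ltW nt0)); move: le1; rewrite mulrBr mulrA divff ?gt_eqF// mul1r.
      by lra.
split; first by move=> [x r] Gx; exists (x, r) => //; exists 0;
  rewrite /= scale0r mul0r !addr0.
by exists c, (0, 0) => //; exists 1; rewrite /= scale1r mul1r !add0r.
Qed.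

Lemma dominated_graph_total G : dominated_graph G ->
  exists2 G', dominated_graph G' & G `<=` G' /\ forall v, exists r, G' (v, r).
Proof.
move=> DG.
(* Joining [G] to each [A] makes the union of an empty chain admissible. *)
have [|M [DM Mmax]] := @Zorn_bigcup _ [set A | dominated_graph (A `|` G)].
  move=> F FP Ftot; rewrite /mkset; have [G0 GL Gp] := DG.
  have pair u w : (\bigcup_(X in F) X `|` G) u -> (\bigcup_(X in F) X `|` G) w ->
      (G u /\ G w) \/ exists2 X, F X & (X `|` G) u /\ (X `|` G) w.
    move=> [[X FX Xu]|Gu] [[Y FY Yw]|Gw]; last by left.
    - have [XY|YX] := Ftot _ _ FX FY; right.
        by exists Y => //; split; left => //; exact: XY.
      by exists X => //; split; left => //; exact: YX.
    - by right; exists X => //; split; [left|right].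
    - by right; exists Y => //; split; [right|left].
  split; first by right.
  - move=> a u w /pair /[apply] -[[Gu Gw]|[X FX [Xu Xw]]].
      by right; exact: GL.
    have [_ XL _] := FP _ FX; have [?|?] := XL a _ _ Xu Xw; last by right.
    by left; exists X.
  - move=> u [[X FX Xu]|]; last exact: Gp.
    by have [_ _] := FP _ FX; apply; left.
exists (M `|` G) => //; split=> [|v]; first by right.
have [G' DG' [MG' [r G'v]]] := dominated_graph_extend v DM.
exists r; apply: contrapT => nMv.
have GG' : G' `|` G = G'.
  by apply/setUidl => u Gu; apply: MG'; right.
apply: (Mmax G'); last by rewrite /mkset GG'.
split; last by move=> /(_ _ G'v) Mv; apply: nMv; left.
by move=> u Mu; apply: MG'; left.
Qed.

(** The map [i] replaces the inclusion of a subspace. It may fail to be injective, since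
    [psi u <= p (i u)] forces [psi] to vanish on its kernel. *)
Theorem hahn_banach (U : lmodType R) (i : U -> V) (psi : U -> R) :
  linear i -> (forall a u w, psi (a *: u + w) = a * psi u + psi w) ->
  (forall u, psi u <= p (i u)) ->
  exists F : {linear V -> R^o}, (forall x, F x <= p x) /\ (forall u, F (i u) = psi u).
Proof.
move=> li lpsi psip.
have i0 : i 0 = 0.
  by have := li (-1) 0 0; rewrite !scaleN1r oppr0 addr0 addNr.
have psi0 : psi 0 = 0.
  by have := lpsi (-1) 0 0; rewrite scaleN1r oppr0 addr0 mulN1r addNr.
have [|G' DG' [GG' G'T]] := @dominated_graph_total [set (i u, psi u) | u in setT].
  split; first by exists 0 => //; rewrite i0 psi0.
  - move=> a _ _ [u _ <-] [w _ <-] /=; exists (a *: u + w) => //.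
    by rewrite li lpsi.
  - by move=> _ [u _ <-]; exact: psip.
have [F HF] := choice G'T; have [_ GL Gp] := DG'.
have lF : linear (F : V -> R^o).
  move=> a x y; apply: (dominated_graph_uniq DG' (HF _)).
  exact: (GL a _ _ (HF x) (HF y)).
pose lFM := GRing.isLinear.Build R V R^o *:%R (F : V -> R^o) lF.
pose Fl : {linear V -> R^o} := HB.pack (F : V -> R^o) lFM.
exists Fl; split.
- by move=> x; exact: (Gp _ (HF x)).
- move=> u; apply: (dominated_graph_uniq DG' (HF _)).
  by apply: GG'; exists u.
Qed.
End HahnBanach.

(** * Norming functionals and sums of operator norms *)

Section BoundedOpTheory.
Context {R : realType}.

Lemma bounded_op_of (V W : normedModType R) (f : V -> W) (C : R) :
  linear f -> (forall x, `|f x| <= C * `|x|) ->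
  exists T : bounded_op V W, forall x, T x = f x.
Proof.
move=> lf fC.
have cf : continuous f.
  pose lfM := GRing.isLinear.Build R V W *:%R f lf.
  pose fl : {linear V -> W} := HB.pack f lfM.
  apply: (@bounded_linear_continuous _ _ _ fl); apply/bounded_funP => r.
  exists (`|C| * r) => x xr; apply: (le_trans (fC x)).
  by apply: (le_trans (ler_norm _)); rewrite normrM normr_id ler_wpM2l.
have fP : f \in clinear by apply/clinearP.
by exists (BoundedOp fP).
Qed.

Lemma bop_ext (V W : normedModType R) (S T : bounded_op V W) :
  (forall x, S x = T x) -> S = T.
Proof. by move=> ST; apply/val_inj/funext. Qed.

Lemma norming_functional (V : normedModType R) (x : V) :
  exists2 phi : dual V, `|phi| <= 1 & phi x = `|x|.
Proof.
have [||||| F [Fp Fx]] := @hahn_banach R V (fun y => `|y|) _ _ R^o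
  (fun t => (t : R) *: x) (fun t => (t : R) * `|x|).
- exact: ler_normD.
- by move=> a y a0; rewrite normrZ ger0_norm.
- by move=> a u w; rewrite scalerDl scalerA.
- by move=> a u w; rewrite mulrDl mulrA.
- by move=> u; rewrite normrZ ler_wpM2r// ler_norm.
have FN y : `|F y| <= 1 * `|y|.
  rewrite mul1r ler_norml Fp andbT -normrN.
  by rewrite lerNl -[leLHS]/(- (F y)) -linearN Fp.
have [phi phiF] := @bounded_op_of V R^o F 1 (@linearP _ _ _ _ F) FN.
exists phi; last by rewrite phiF; have := Fx 1; rewrite scale1r mul1r.
by apply: opnorm_le => y y1; rewrite phiF (le_trans (FN y))// mul1r.
Qed.

(** Each [T i] is tested on its own nearly norming vector, the error being shared among the indices.
    This is how the dual of a sup norm is seen to be an l1 norm. *)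
Lemma sum_opnorm_le (I : finType) (V W : normedModType R)
    (T : I -> bounded_op V W) (M : R) :
  (forall v, (forall i, `|v i| <= 1) -> \sum_i `|T i (v i)| <= M) ->
  \sum_i `|T i| <= M.
Proof.
move=> TM; apply/ler_addgt0Pr => e e0.
have d0 : 0 < e / (#|I|.+1)%:R by rewrite divr_gt0.
have ex i : exists v, `|v| <= 1 /\ `|T i| - e / (#|I|.+1)%:R <= `|T i v|.
  have [_ [v /= v1 <-] vT] := sup_adherent d0 (has_sup_opnorm (T i)).
  by exists v; split=> //; exact: ltW.
have [v Hv] := choice ex.
have := TM v (fun i => (Hv i).1); rewrite -(lerD2r e); apply: le_trans.
have le1 : \sum_i `|T i| - \sum_(i : I) (e / (#|I|.+1)%:R) <= \sum_i `|T i (v i)|.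
  by rewrite -sumrB; apply: ler_sum => i _; exact: (Hv i).2.
rewrite -lerBlDr; apply: le_trans le1; rewrite lerB// sumr_const.
rewrite -[leLHS]mulr_natr mulrAC ler_pdivrMr// ler_pM2l// ler_nat.
exact: leqnSn.
Qed.

End BoundedOpTheory.

Section WeakL1.
Context {R : realType} {V : normedModType R}.
Implicit Types phi : dual V.

Lemma has_sup_weak_l1 n (x : 'I_n -> V) :
  has_sup [set \sum_(i < n) `|phi (x i)| | phi in [set phi : dual V | `|phi| <= 1]].
Proof.
split; first by exists (\sum_(i < n) `|(0 : dual V) (x i)|), 0 => //=; rewrite normr0.
exists (\sum_(i < n) `|x i|) => _ [phi /= phi1 <-]; apply: ler_sum => i _.
by rewrite (le_trans (ler_opnorm phi _))// ler_piMl.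
Qed.

Lemma weak_l1_ub n (x : 'I_n -> V) phi :
  `|phi| <= 1 -> \sum_(i < n) `|phi (x i)| <= weak_l1 x.
Proof.
by move=> phi1; apply: ub_le_sup; [exact: (has_sup_weak_l1 x).2|exists phi].
Qed.

Lemma weak_l1_le n (x : 'I_n -> V) M :
  (forall phi, `|phi| <= 1 -> \sum_(i < n) `|phi (x i)| <= M) -> weak_l1 x <= M.
Proof.
move=> xM; apply: ge_sup; first exact: (has_sup_weak_l1 x).1.
by move=> _ [phi /= /xM ? <-].
Qed.

Lemma weak_l1_ge0 n (x : 'I_n -> V) : 0 <= weak_l1 x.
Proof.
have [phi phi1 _] := norming_functional (0 : V).
by apply: le_trans (weak_l1_ub x phi1); apply: sumr_ge0.
Qed.

Lemma weak_l1_sum n (x : 'I_n -> V) (a : 'I_n -> R) :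
  (forall i, `|a i| <= 1) -> `|\sum_i a i *: x i| <= weak_l1 x.
Proof.
move=> a1; have [phi phi1 <-] := norming_functional (\sum_i a i *: x i).
apply: le_trans (weak_l1_ub x phi1); rewrite linear_sum.
apply: ler_sum => i _; rewrite linearZ; apply: (le_trans (ler_norm _)).
by rewrite normrM ler_piMl.
Qed.

(** The signs of the [phi (x i)] turn the sum of moduli into the value of [phi] at one signed sum.
    The weak l1-norm thus becomes a sup norm over the finite set of sign patterns. *)
Lemma weak_l1_signs n (x : 'I_n -> V) M :
  (forall e : {ffun 'I_n -> bool}, `|\sum_i (-1) ^+ e i *: x i| <= M) ->
  weak_l1 x <= M.
Proof.
move=> xM; apply: weak_l1_le => phi phi1.
pose e := [ffun i => phi (x i) < 0].
apply: le_trans (xM e).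
have -> : \sum_(i < n) `|phi (x i)| = phi (\sum_i (-1) ^+ e i *: x i).
  rewrite linear_sum; apply: eq_bigr => i _; rewrite linearZ /e ffunE.
  by rewrite normrEsign.
apply: (le_trans (ler_norm _)); apply: (le_trans (ler_opnorm phi _)).
by rewrite ler_piMl.
Qed.

End WeakL1.

(** * Adjoints of 1-summing operators *)

Section Bidual.
Context {R : realType} {H V W : normedModType R}.

(* Extending over V^(2^n) splits the functional s_k S(u_k) as
   sum_theta theta_k chi_theta with sum |chi_theta| <= C. *)
Lemma summing_bound_adjoint (S : bounded_op H (dual V)) (T : bounded_op V W) C :
  (forall u v, `|S u v| <= `|u| * `|T v|) ->
  summing_bound T C -> summing_bound (adjoint S) C.
Proof.
move=> ST [C0 TC]; split=> // n x.
apply: sum_opnorm_le => u u1.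
(* Operator norms have been replaced by values at vectors [u k] of the unit ball; the signs make
   each of these values contribute its modulus. *)
pose s k : R := Num.sg (x k (S (u k))).
have s1 k : `|s k| <= 1 by rewrite normr_sg; case: (_ == _).
(* With [M] this is a sup-norm space over all sign patterns. The map [i] below sends a family to its
   signed sums, so [M (i v)] dominates the weak l1-norm of [v]. *)
pose Y := {ffun {ffun 'I_n -> bool} -> V}.
pose M (y : Y) : R := \big[Num.max/0]_t `|y t|.
have My (y : Y) t : `|y t| <= M y by exact: le_bigmax.
have MM (y : Y) r : 0 <= r -> (forall t, `|y t| <= r) -> M y <= r.
  by move=> r0 yr; apply: bigmax_le.
have M0 y : 0 <= M y by exact: bigmax_ge_id.
pose i (v : {ffun 'I_n -> V}) : Y := [ffun t => \sum_k (-1) ^+ (t : {ffun 'I_n -> bool}) k *: v k].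
pose psi (v : {ffun 'I_n -> V}) : R := \sum_k s k * S (u k) (v k).
have [||||| F [Fp Fi]] := @hahn_banach R Y (fun y => C * M y) _ _
  {ffun 'I_n -> V} i psi.
- move=> y z; rewrite -mulrDr ler_wpM2l//; apply: MM; first exact: addr_ge0.
  by move=> t; rewrite ffunE (le_trans (ler_normD _ _))// lerD.
- move=> a y a0; rewrite mulrCA; congr (_ * _).
  have le b z : 0 <= b -> M (b *: z) <= b * M z.
    move=> b0; apply: MM; first exact: mulr_ge0.
    by move=> t; rewrite ffunE normrZ ger0_norm// ler_wpM2l.
  apply/eqP; rewrite eq_le le//=.
  have [->|an0] := eqVneq a 0; first by rewrite mul0r.
  rewrite mulrC -ler_pdivlMr ?lt_def ?an0// mulrC.
  by apply: le_trans (le _ _ _); rewrite ?invr_ge0// scalerA mulVf// scale1r.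
- move=> a v w; apply/ffunP => t; rewrite !ffunE scaler_sumr -big_split.
  by apply: eq_bigr => k _ /=; rewrite !ffunE scalerDr !scalerA mulrC.
- move=> a v w; rewrite mulr_sumr -big_split; apply: eq_bigr => k _ /=.
  by rewrite !ffunE linearP /= mulrDr mulrCA.
- move=> v; apply: (@le_trans _ _ (\sum_k `|T (v k)|)).
    apply: ler_sum => k _; apply: (le_trans (ler_norm _)); rewrite normrM.
    apply: (@le_trans _ _ (1 * (1 * `|T (v k)|))); last by rewrite !mul1r.
    apply: ler_pM => //; apply: (le_trans (ST _ _)).
    by rewrite ler_wpM2r.
  apply: (le_trans (TC _ _)); rewrite ler_wpM2l//.
  by apply: weak_l1_signs => t; have := My (i v) t; rewrite ffunE.
pose dl t v : Y := [ffun t' => if t' == t then v else 0].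
have dlL t : linear (dl t).
  move=> a v w; apply/ffunP => t'; rewrite !ffunE.
  by case: ifP => // _; rewrite scaler0 addr0.
have dlM t v : M (dl t v) <= `|v|.
  apply: MM => // t'; rewrite ffunE; case: ifP => // _; by rewrite normr0.
(* [chi t] is the restriction of [F] to the coordinate [t] of [Y]. *)
have chiP t : exists chi : dual V, forall v, chi v = F (dl t v).
  apply: (@bounded_op_of _ V R^o (fun v => F (dl t v)) C).
    by move=> a v w; rewrite dlL linearP.
  have le v : F (dl t v) <= C * `|v|.
    by apply: (le_trans (Fp _)); rewrite ler_wpM2l.
  move=> v; rewrite ler_norml le andbT lerNl -normrN.
  apply: le_trans (le (- v)); rewrite -[leLHS]/(- F (dl t v)) -linearN.
  suff -> : - dl t v = dl t (- v) by [].
  by apply/ffunP => t'; rewrite !ffunE; case: ifP => // _; rewrite oppr0.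
have [chi chiF] := choice chiP.
have dl_sum (y : Y) : y = \sum_t dl t (y t).
  apply/ffunP => t; rewrite sum_ffunE (bigD1 t)//= ffunE eqxx big1 ?addr0//.
  by move=> t' /negPf tt'; rewrite ffunE eq_sym tt'.
have chiC : \sum_t `|chi t| <= C.
  apply: sum_opnorm_le => v v1.
  pose y : Y := [ffun t => Num.sg (chi t (v t)) *: v t].
  have -> : \sum_t `|chi t (v t)| = F y.
    rewrite [y]dl_sum linear_sum; apply: eq_bigr => t _.
    by rewrite -chiF ffunE linearZ /= normrEsg.
  apply: (le_trans (Fp y)); rewrite ler_piMr//; apply: MM => // t.
  rewrite ffunE normrZ normr_sg; case: (_ == _) => /=; last by rewrite mul1r.
  by rewrite mul0r.
have sS k : s k *: S (u k) = \sum_t (-1) ^+ (t : {ffun 'I_n -> bool}) k *: chi t.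
  apply: bop_ext => v.
  pose w : {ffun 'I_n -> V} := [ffun j => if j == k then v else 0].
  have psiw : psi w = s k * S (u k) v.
    rewrite /psi (bigD1 k)//= ffunE eqxx big1 ?addr0// => j /negPf jk.
    by rewrite ffunE jk linear0 mulr0.
  rewrite -[LHS]/(s k * S (u k) v) -psiw -Fi [i w]dl_sum linear_sum.
  have ev : {morph (fun f : dual V => f v) : f g / f + g} by [].
  rewrite (big_morph _ ev (erefl : (0 : dual V) v = 0)).
  apply: eq_bigr => t _; rewrite -chiF ffunE.
  rewrite (bigD1 k)//= ffunE eqxx big1 ?addr0; last first.
    by move=> j /negPf jk; rewrite ffunE jk scaler0.
  by rewrite linearZ.
(* Only here does the bidual enter: the splitting is a finite identity in [dual V], so the [x k] can
   be applied to it term by term. *)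
have -> : \sum_k `|adjoint S (x k) (u k)| =
    \sum_t (\sum_k (-1) ^+ (t : {ffun 'I_n -> bool}) k *: x k) (chi t).
  transitivity (\sum_k x k (s k *: S (u k))).
    by apply: eq_bigr => k _; rewrite linearZ /= normrEsg.
  under eq_bigr => k _ do rewrite sS linear_sum.
  rewrite exchange_big; apply: eq_bigr => t _.
  have ev : {morph (fun f : dual (dual V) => f (chi t)) : f g / f + g} by [].
  rewrite (big_morph _ ev (erefl : (0 : dual (dual V)) (chi t) = 0)).
  by apply: eq_bigr => k _; rewrite linearZ.
apply: (@le_trans _ _ (\sum_t weak_l1 x * `|chi t|)).
  apply: ler_sum => t _; apply: (le_trans (ler_norm _)).
  apply: (le_trans (ler_opnorm _ _)); rewrite ler_wpM2r//.
  apply: (@weak_l1_sum _ _ _ x (fun k => (-1) ^+ t k)) => k.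
  by rewrite normrX normrN1 expr1n.
rewrite -mulr_sumr mulrC ler_wpM2r//; exact: weak_l1_ge0.
Qed.

End Bidual.

(** * Pisier's domination theorem for finite cotype *)

Section Cotype.
Context {R : realType}.

(** Convexity: at [c] the power lies above its tangent at [a], and [c - a >= - b]. *)
Lemma bernoulli_power (a c b : R) M : 0 <= a -> 0 <= c -> a - b <= c ->
  a ^+ M.+1 - M.+1%:R * a ^+ M * b <= c ^+ M.+1.
Proof.
move=> a0 c0 abc.
have tangent : 0 <= c ^+ M.+1 - a ^+ M.+1 - M.+1%:R * a ^+ M * (c - a).
  elim: M => [|M IH]; first by rewrite !expr1 expr0; lra.
  rewrite [X in 0 <= X](_ : _ = c * (c ^+ M.+1 - a ^+ M.+1 - M.+1%:R * a ^+ M * (c - a))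
    + M.+1%:R * a ^+ M * (c - a) ^+ 2); last first.
    rewrite [c ^+ M.+2]exprS [a ^+ M.+2]exprS [a ^+ M.+1]exprS.
    by rewrite -[M.+2]addn1 natrD; ring.
  by rewrite addr_ge0// mulr_ge0// ?sqr_ge0// mulr_ge0// exprn_ge0.
have : 0 <= M.+1%:R * a ^+ M * (b - (a - c)).
  by rewrite mulr_ge0 ?subr_ge0//; [rewrite mulr_ge0// exprn_ge0|lra].
by move: tangent; rewrite !mulrBr; lra.
Qed.

(** A bound on all signed sums bounds their quadratic average. After division by a cotype constant
    every term has norm at most 1, so the real exponent [q] can be raised to an integer. *)
Lemma cotype_power_bound (X : normedModType R) : finite_cotype X ->
  exists N : nat, exists2 A : R, 0 <= A &
    forall m (y : 'I_m -> X),
      (forall e : {ffun 'I_m -> bool}, `|\sum_i (-1) ^+ e i *: y i| <= 1) ->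
      \sum_i `|y i| ^+ N.+1 <= A.
Proof.
move=> [q [q2 [C HC]]].
(* The maximum makes the constant positive, as the division by it requires. *)
pose c := Num.max 1 C.
have c0 : 0 < c by rewrite lt_max ltr01.
pose N := Num.truncn q.
have qN : q <= N.+1%:R by apply/ltW/truncnS_gt.
have q0 : 0 < q by lra.
have q1 : (1 : R) `^ q = 1 by rewrite powR1.
exists N, (c ^+ N.+1); first by rewrite exprn_ge0// ltW.
move=> m y y1.
pose z i := c^-1 *: y i.
have zq : \sum_i `|z i| `^ q <= 1.
  have S0 : 0 <= \sum_i `|z i| `^ q by apply: sumr_ge0 => i _; exact: powR_ge0.
  suff : (\sum_i `|z i| `^ q) `^ q^-1 <= 1.
    move=> le1; rewrite -[leLHS]powRr1// -{1}(mulVf (lt0r_neq0 q0)) powRrM.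
    by rewrite -[leRHS]q1 ge0_ler_powR// ?nnegrE ?powR_ge0// ltW.
  apply: (le_trans (HC _ _)); apply: (@le_trans _ _ (c * c^-1)); last first.
    by rewrite mulfV ?gt_eqF.
  apply: (@le_trans _ _ (c * Num.sqrt ((2 ^+ m)^-1 *
      \sum_(eps : {ffun 'I_m -> bool}) `|\sum_(i < m) (-1) ^+ eps i *: z i| ^+ 2))).
    by rewrite ler_wpM2r ?sqrtr_ge0// le_max lexx orbT.
  rewrite ler_pM2l//.
  have cV0 : 0 <= c^-1 by rewrite invr_ge0 ltW.
  rewrite -[leRHS](ger0_norm cV0) -sqrtr_sqr ler_wsqrtr//.
  rewrite mulrC ler_pdivrMr ?exprn_gt0//.
  apply: (@le_trans _ _ (\sum_(eps : {ffun 'I_m -> bool}) c^-1 ^+ 2)).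
    apply: ler_sum => e _; rewrite lerXn2r// ?nnegrE//.
    have -> : \sum_i (-1) ^+ e i *: z i = c^-1 *: \sum_i (-1) ^+ e i *: y i.
      by rewrite scaler_sumr; apply: eq_bigr => i _; rewrite !scalerA mulrC.
    by rewrite normrZ ger0_norm// ler_piMr.
  rewrite sumr_const card_ffun card_bool card_ord -[leLHS]mulr_natr natrX.
  exact: lexx.
have z1 i : `|z i| <= 1.
  have : `|z i| `^ q <= 1.
    by apply: le_trans zq; rewrite (bigD1 i)//= lerDl sumr_ge0//.
  rewrite leNgt => h; rewrite leNgt; apply/negP => z1; move/negP: h; apply.
  by rewrite -[ltLHS]q1 gt0_ltr_powR// ?nnegrE.
have -> : \sum_i `|y i| ^+ N.+1 = c ^+ N.+1 * \sum_i `|z i| ^+ N.+1.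
  rewrite mulr_sumr; apply: eq_bigr => i _.
  rewrite -exprMn; congr (_ ^+ _).
  by rewrite /z normrZ gtr0_norm ?invr_gt0// mulrA mulfV ?mul1r// gt_eqF.
rewrite ler_piMr ?exprn_ge0 ?(ltW c0)//; apply: le_trans zq.
apply: ler_sum => i _; rewrite -powR_mulrn//.
have [->|zi0] := eqVneq `|z i| 0.
  by rewrite powR0 ?pnatr_eq0// powR_ge0.
by apply: ger_powR => //; rewrite z1 lt_def zi0 normr_ge0.
Qed.

(** As a function of [f] this is an operator from the n-dimensional sup-norm space to [X], of norm
    at most [weak_l1 x]; this is the operator on a C(K) space to which Pisier's theorem applies. *)
Definition lin_comb (X : normedModType R) n (x : 'I_n -> X) (f : 'I_n -> R) : X :=
  \sum_k f k *: x k.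

Lemma norming_lin_comb (X : normedModType R) n (x : 'I_n -> X) (f : 'I_n -> R)
    (xi : dual X) : xi (lin_comb x f) = \sum_k f k * xi (x k).
Proof. by rewrite linear_sum; apply: eq_bigr => k _; rewrite linearZ. Qed.

Lemma dual_ball_le (X : normedModType R) (phi : dual X) x :
  `|phi| <= 1 -> (phi x : R) <= `|x|.
Proof.
move=> phi1; apply: (le_trans (ler_norm _)).
by apply: (le_trans (ler_opnorm phi _)); rewrite ler_piMl.
Qed.

Section PisierDomination.
Context {X : normedModType R} (N : nat) (A : R).
Hypothesis XNA : forall m (y : 'I_m -> X),
  (forall e : {ffun 'I_m -> bool}, `|\sum_i (-1) ^+ e i *: y i| <= 1) ->
  \sum_i `|y i| ^+ N.+1 <= A.
Context n (x : 'I_n -> X).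
Hypothesis x1 : weak_l1 x <= 1.
Local Notation u := (lin_comb x).

(** Signed sums of the [f i] stay in the unit ball of the sup norm, on which [u] takes values of
    norm at most 1. *)
Lemma lin_comb_family m (f : 'I_m -> 'I_n -> R) :
  (forall k, \sum_i `|f i k| <= 1) -> \sum_i `|u (f i)| ^+ N.+1 <= A.
Proof.
move=> f1; apply: XNA => e; apply: le_trans x1.
have -> : \sum_i (-1) ^+ e i *: u (f i) = \sum_k (\sum_i (-1) ^+ e i * f i k) *: x k.
  under eq_bigr => i _ do rewrite scaler_sumr.
  rewrite exchange_big; apply: eq_bigr => k _ /=.
  by rewrite scaler_suml; apply: eq_bigr => i _; rewrite scalerA.
apply: weak_l1_sum => k; apply: le_trans (f1 k).
apply: (le_trans (ler_norm_sum _ _ _)); apply: ler_sum => i _.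
by rewrite normrM normrX normrN1 expr1n mul1r.
Qed.

(* Pisier's extrapolation trick: for a nearly extremal family (f_i), testing
   the extremality against the family g, (1 - |g|) f_i bounds |u g|^N by a
   positive functional of |g|. *)
Lemma pisier_level (eps : R) : 0 < eps ->
  exists phi : 'I_n -> R, \sum_k `|phi k| <= A + A /\
    forall g : 'I_n -> R, (forall k, `|g k| <= 1) ->
      `|u g| ^+ N.+1 <= eps + N.+1%:R * \sum_k `|g k| * `|phi k|.
Proof.
move=> eps0.
pose S := [set r : R | exists m (f : 'I_m -> 'I_n -> R),
  (forall k, \sum_i `|f i k| <= 1) /\ r = \sum_i `|u (f i)| ^+ N.+1].
have supS : has_sup S.
  split; last by exists A => _ [m [f [f1 ->]]]; exact: lin_comb_family.
  exists 0, 0%N, (fun _ _ => 0); split=> [k|]; last by rewrite big_ord0.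
  by rewrite big_ord0.
have [_ [m [f [f1 ->]]] fS] := sup_adherent eps0 supS.
have [xi Hxi] := choice (fun i =>
  let: ex_intro2 phi p q := norming_functional (u (f i)) in
  ex_intro (fun phi : dual X => `|phi| <= 1 /\ phi (u (f i)) = `|u (f i)|)
    phi (conj p q)).
pose a i := `|u (f i)|.
have a0 i : 0 <= a i by exact: normr_ge0.
(* Up to the factor [N.+1] this is the derivative of the nearly extremal sum when the [f i] are
   multiplied by a common function: the norming functionals [xi i] get the weights [a i ^+ N]. *)
pose phi k := \sum_i a i ^+ N * (f i k * xi i (x k)).
have phiE (h : 'I_n -> R) : \sum_k h k * phi k =
    \sum_i a i ^+ N * xi i (u (fun k => h k * f i k)).
  under eq_bigr => k _ do rewrite mulr_sumr.
  rewrite exchange_big; apply: eq_bigr => i _ /=.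
  rewrite norming_lin_comb mulr_sumr; apply: eq_bigr => k _; ring.
exists phi; split.
  have -> : \sum_k `|phi k| = \sum_k Num.sg (phi k) * phi k.
    by apply: eq_bigr => k _; rewrite normrEsg.
  rewrite phiE; pose h i k := Num.sg (phi k) * f i k.
  have h1 k : \sum_i `|h i k| <= 1.
    apply: le_trans (f1 k); apply: ler_sum => i _.
    rewrite normrM normr_sg; case: (_ == _) => /=; last by rewrite mul1r.
    by rewrite mul0r.
  (* The product [a ^+ N * b] is at most [a ^+ N.+1 + b ^+ N.+1], by comparison with the larger of
     the two. Each of the two families contributes [A], whence [A + A]. *)
  apply: le_trans (lerD (lin_comb_family f1) (lin_comb_family h1)).
  rewrite -big_split; apply: ler_sum => i _ /=.
  apply: (@le_trans _ _ (a i ^+ N * `|u (h i)|)).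
    rewrite ler_wpM2l ?exprn_ge0//; apply: (dual_ball_le _ (Hxi i).1).
  have [le|/ltW le] := leP (a i) `|u (h i)|.
    apply: (@le_trans _ _ (`|u (h i)| ^+ N.+1)); last by rewrite lerDr exprn_ge0.
    by rewrite exprSr ler_wpM2r// lerXn2r// nnegrE.
  apply: (@le_trans _ _ (a i ^+ N.+1)); last by rewrite lerDl exprn_ge0.
  by rewrite exprSr ler_wpM2l// exprn_ge0.
move=> g g1.
(* Pointwise this family sums to at most [|g| + (1 - |g|)], so it competes in [S]. *)
pose h (i : 'I_m.+1) k : R :=
  if unlift ord0 i is Some j then (1 - `|g k|) * f j k else g k.
have h1 k : \sum_i `|h i k| <= 1.
  rewrite big_ord_recl /h unlift_none.
  under eq_bigr => i _ do rewrite liftK normrM ger0_norm ?subr_ge0//.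
  rewrite -mulr_sumr; have := f1 k; have := g1 k.
  by have := normr_ge0 (g k); nra.
have hS : \sum_i `|u (h i)| ^+ N.+1 <= sup S.
  by apply: ub_le_sup; [exact: supS.2|exists m.+1, h].
have {fS} := lt_le_trans fS (le_refl _); rewrite ltrBlDr => fS.
have := le_lt_trans hS fS; rewrite big_ord_recl => lt1.
have h0 : h ord0 = g by apply/funext => k; rewrite /h unlift_none.
rewrite h0 in lt1.
have hi i : h (lift ord0 i) = fun k => (1 - `|g k|) * f i k.
  by apply/funext => k; rewrite /h liftK.
pose b i := xi i (u (fun k => `|g k| * f i k)).
have le2 : \sum_i (a i ^+ N.+1 - N.+1%:R * a i ^+ N * b i) <=
    \sum_i `|u (h (lift ord0 i))| ^+ N.+1.
  apply: ler_sum => i _; apply: bernoulli_power => //.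
  have -> : a i - b i = xi i (u (h (lift ord0 i))).
    rewrite /a -(Hxi i).2 /b hi !norming_lin_comb -sumrB; apply: eq_bigr => k _.
    by ring.
  apply: (dual_ball_le _ (Hxi i).1).
have le3 : \sum_i a i ^+ N * b i <= \sum_k `|g k| * `|phi k|.
  rewrite -phiE; apply: ler_sum => k _.
  by rewrite ler_wpM2l// ler_norm.
have e4 : \sum_i (a i ^+ N.+1 - N.+1%:R * a i ^+ N * b i) =
    \sum_i a i ^+ N.+1 - N.+1%:R * \sum_i a i ^+ N * b i.
  rewrite mulr_sumr -sumrB; apply: eq_bigr => i _; ring.
move: le2; rewrite e4 => le2.
have le5 : N.+1%:R * \sum_i a i ^+ N * b i <= N.+1%:R * \sum_k `|g k| * `|phi k|.
  by rewrite ler_wpM2l.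
have e6 : \sum_i a i ^+ N.+1 = \sum_i `|u (f i)| ^+ N.+1 by [].
lra.
Qed.

(** The coefficients are cut according to the integer part [j] of [|a k|], and [pisier_level] is
    applied to each level. Either a level contributes at most [2^-j], and these bounds sum to less
    than 2, or its contribution is at most a power of [2^j] times its mass under [mu], and the
    exponential absorbs that power. *)
Lemma pisier_domination : exists mu : 'I_n -> R,
  [/\ forall k, 0 <= mu k, \sum_k mu k <= N.+1%:R * (A + A) + 1 &
   forall a : 'I_n -> R,
     `|u a| <= 2 + \sum_k mu k * expR ((2 * N.+1)%:R * `|a k|)].
Proof.
have eps0 : 0 < (n.+1%:R)^-1 :> R by rewrite invr_gt0.
have [phi [phiA phig]] := pisier_level eps0.
pose eps : R := (n.+1%:R)^-1.
(* With [eps] added at each point, every nonempty level carries the additive error of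
   [pisier_level]; since [eps] is [1/(n+1)], the extra mass is at most 1. *)
pose mu k := N.+1%:R * `|phi k| + eps.
have mu0 k : 0 <= mu k by rewrite addr_ge0 ?mulr_ge0// ltW.
exists mu; split=> //.
  rewrite big_split /= -mulr_sumr lerD//; first by rewrite ler_wpM2l.
  rewrite sumr_const card_ord -[leLHS]mulr_natr mulrC ler_pdivrMr// mul1r.
  by rewrite ler_nat leqnSn.
have level (L : pred 'I_n) (g : 'I_n -> R) : (forall k, `|g k| <= 1) ->
    (forall k, ~~ L k -> g k = 0) -> `|u g| ^+ N.+1 <= \sum_(k | L k) mu k.
  move=> g1 gL; have [k0 Lk0|L0] := pickP L; last first.
    rewrite [u g]big1 ?normr0 ?expr0n ?sumr_ge0// => k _.
    by rewrite gL ?L0// scale0r.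
  apply: (le_trans (phig g g1)); rewrite [leLHS]addrC [leRHS]big_split /= lerD//.
    rewrite -mulr_sumr ler_wpM2l// [leRHS]big_mkcond /=; apply: ler_sum => k _.
    case: ifPn => [_|/gL ->]; last by rewrite normr0 mul0r.
    by rewrite ler_piMl.
  by rewrite (bigD1 k0)//= lerDl sumr_ge0// => k _; rewrite ltW.
move=> a.
pose t k := Num.truncn `|a k|.
have tle k : (t k)%:R <= `|a k| by rewrite truncn_le.
have tlt k : `|a k| < (t k).+1%:R by rewrite truncnS_gt.
pose J := (\max_k t k).+1.
have tJ k : (t k < J)%N by rewrite ltnS; exact: leq_bigmax.
pose g j k : R := if t k == j then a k / j.+1%:R else 0.
have uaE : u a = \sum_(j < J) j.+1%:R *: u (g j).
  under [RHS]eq_bigr => j _ do rewrite scaler_sumr.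
  rewrite exchange_big; apply: eq_bigr => k _ /=.
  rewrite (bigD1 (Ordinal (tJ k)))//= big1 ?addr0; last first.
    move=> j; rewrite -val_eqE /= /g eq_sym => /negPf ->.
    by rewrite scale0r scaler0.
  by rewrite /g eqxx scalerA mulrC divfK.
have gle j : j.+1%:R * `|u (g j)| <=
    2^-1 ^+ j + \sum_(k | t k == j) mu k * expR ((2 * N.+1)%:R * `|a k|).
  have H : `|u (g j)| ^+ N.+1 <= \sum_(k | t k == j) mu k.
    apply: (level (fun k => t k == j)) => k; rewrite /g; last by move=> /negPf ->.
    case: eqP => [<-|_]; last by rewrite normr0.
    by rewrite normrM normfV normr_nat ler_pdivrMr// mul1r ltW.
  have [le|lt] := leP (j.+1%:R * `|u (g j)|) (2^-1 ^+ j).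
    rewrite (le_trans le)// lerDl sumr_ge0// => k _.
    by rewrite mulr_ge0// expR_ge0.
  apply: (@le_trans _ _ (\sum_(k | t k == j) mu k * expR ((2 * N.+1)%:R * `|a k|))); last first.
    by rewrite lerDr exprn_ge0.
  apply: (@le_trans _ _ (\sum_(k | t k == j) mu k * (2 ^+ j) ^+ (2 * N.+1))); last first.
    apply: ler_sum => k /eqP tk; rewrite ler_wpM2l//.
    apply: (@le_trans _ _ (expR ((2 * N.+1)%:R * j%:R))).
      rewrite mulrC expRM_natr.
      rewrite lerXn2r ?nnegrE ?exprn_ge0 ?expR_ge0//.
      rewrite -[j%:R]mul1r expRM_natr lerXn2r ?nnegrE ?expR_ge0//.
      by apply: le_trans (expR_ge1Dx 1).
    by rewrite ler_expR ler_wpM2l// -tk.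
  rewrite -mulr_suml; apply: (@le_trans _ _ (`|u (g j)| ^+ N.+1 *
      (2 ^+ j) ^+ (2 * N.+1))); last first.
    by rewrite ler_wpM2r// !exprn_ge0.
  set y := `|u (g j)| in lt *; set z : R := 2 ^+ j.
  have z0 : 0 < z by rewrite exprn_gt0.
  have jz : j.+1%:R <= z by rewrite /z -natrX ler_nat ltn_expl.
  have y0 : 0 <= y by exact: normr_ge0.
  (* As this quantity is at least 1, passing from [z * y] to the power [N.+1] of [z * y * z] can
     only increase; this power contains [z ^+ (2 * N.+1)], which explains the rate in the
     exponential. *)
  have w1 : 1 <= z * y * z.
    move: lt; rewrite exprVn -/z -(ltr_pM2l z0) divff ?gt_eqF// => /ltW lt.
    apply: (le_trans lt); rewrite -mulrA ler_pM2l// mulrC ler_wpM2l//.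
  apply: (@le_trans _ _ (z * y)); first by rewrite ler_wpM2r.
  have -> : y ^+ N.+1 * z ^+ (2 * N.+1) = z * y * z * (z * y * z) ^+ N.
    by rewrite exprM -exprMn -exprS; congr (_ ^+ _); ring.
  have wN : 1 <= (z * y * z) ^+ N by rewrite exprn_ege1.
  have zy0 : 0 <= z * y by rewrite mulr_ge0// ltW.
  have z1 : 1 <= z by apply: le_trans jz; rewrite ler1n.
  have : z * y <= z * y * z by rewrite ler_peMr.
  move=> h; apply: (le_trans h); by rewrite ler_peMr// mulr_ge0// ltW.
rewrite uaE; apply: (le_trans (ler_norm_sum _ _ _)).
apply: (@le_trans _ _ (\sum_(j < J) (2^-1 ^+ j +
    \sum_(k | t k == j) mu k * expR ((2 * N.+1)%:R * `|a k|)))).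
  by apply: ler_sum => j _; rewrite normrZ normr_nat.
rewrite big_split /= lerD//.
  have : \sum_(j < J) (2^-1 : R) ^+ j = 2 * (1 - 2^-1 ^+ J).
    elim: (J) => [|J' IH]; first by rewrite big_ord0 expr0 subrr mulr0.
    by rewrite big_ord_recr /= IH exprS; field.
  move=> ->; rewrite ler_piMr// gerBl exprn_ge0//.
rewrite (exchange_big_dep xpredT)//=; apply: ler_sum => k _.
rewrite (bigD1 (Ordinal (tJ k)))//= big1 ?addr0//.
by move=> j /andP[/eqP tk]; rewrite -val_eqE /= tk eqxx.
Qed.
End PisierDomination.

Lemma cotype_domination (X : normedModType R) : finite_cotype X ->
  exists N : nat, exists2 B : R, 0 <= B &
    forall n (x : 'I_n -> X), weak_l1 x <= 1 -> exists mu : 'I_n -> R,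
    [/\ forall k, 0 <= mu k, \sum_k mu k <= B & forall a : 'I_n -> R,
     `|\sum_k a k *: x k| <= 2 + \sum_k mu k * expR (N%:R * `|a k|)].
Proof.
move=> /cotype_power_bound[N [A A0 HA]]; exists (2 * N.+1)%N.
exists (N.+1%:R * (A + A) + 1); first by rewrite addr_ge0// mulr_ge0// addr_ge0.
move=> n x x1; exact: (pisier_domination HA).
Qed.

End Cotype.

(** * Independent Gaussian variables *)

Section WeightedTransfer.
Context d d' {T : measurableType d} {T' : measurableType d'} {R : realType}.
Variables (mu : {measure set T -> \bar R}) (nu : {measure set T' -> \bar R}).
Variables (H : T -> R) (Y : T -> T') (c : R).
Hypotheses (mH : measurable_fun setT H) (H0 : forall t, 0 <= H t).
Hypothesis mY : measurable_fun setT Y.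
Hypothesis HY : forall B, measurable B ->
  (\int[mu]_t (H t * \1_B (Y t))%:E = c%:E * nu B)%E.

Import HBNNSimple.

(** The measure with density [H] has image [c nu] under [Y]; the formula passes from indicators to
    simple functions and on by monotone convergence. It serves for Gaussian densities, for the
    reflection of the line, and for replacing one indicator by a general function under
    independence. *)
Lemma ge0_weighted_transfer (f : T' -> R) :
  measurable_fun setT f -> (forall y, 0 <= f y) ->
  (\int[mu]_t (H t * f (Y t))%:E = c%:E * \int[nu]_y (f y)%:E)%E.
Proof.
move=> mf f0.
pose fE : T' -> \bar R := EFin \o f.
have mfE : measurable_fun setT fE by exact/measurable_EFinP.
have f0E y : setT y -> (0 <= fE y)%E by rewrite /fE /= lee_fin.
pose f_ := nnsfun_approx measurableT mfE.
have f_cvg y : EFin \o f_ ^~ y @ \oo --> fE y.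
  exact: cvg_nnsfun_approx.
have f_nd y : nondecreasing_seq (f_ ^~ y).
  by move=> m n mn; exact/lefP/nd_nnsfun_approx.
have mfY n : measurable_fun setT (f_ n \o Y) by exact: measurableT_comp.
have step n : (\int[mu]_t (H t * f_ n (Y t))%:E = c%:E * \int[nu]_y (f_ n y)%:E)%E.
  have mB r : measurable (f_ n @^-1` [set r]).
    by rewrite -[X in measurable X]setTI; exact: measurable_funP.
  have mIY r : measurable_fun setT (fun t => \1_(f_ n @^-1` [set r]) (Y t) : R).
    exact: (measurableT_comp (measurable_indic (mB r)) mY).
  transitivity (\sum_(r \in range (f_ n)) (r%:E * (c%:E * nu (f_ n @^-1` [set r]))))%E.
    transitivity (\int[mu]_t
        (\sum_(r \in range (f_ n)) (r * (H t * \1_(f_ n @^-1` [set r]) (Y t)))%:E))%E.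
      apply: eq_integral => t _.
      rewrite fimfunE mulrC fsumEFin// [in LHS]fsbig_finite// [in RHS]fsbig_finite//=.
      rewrite mulr_suml; congr EFin; apply: eq_bigr => r _; ring.
    rewrite ge0_integral_fsum//.
    - apply: eq_fsbigr => r /set_mem[y _ yr].
      rewrite -HY//; under eq_integral do rewrite EFinM.
      rewrite ge0_integralZl_EFin//.
      + by move=> t _; rewrite lee_fin mulr_ge0.
      + by apply/measurable_EFinP/measurable_funM.
      + by rewrite -yr.
    - by move=> r; apply/measurable_EFinP/measurable_funM => //; exact: measurable_funM.
    - move=> r t _; have [[y _ yr]|nr] := pselect (range (f_ n) r).
        by rewrite lee_fin mulr_ge0 ?mulr_ge0// -yr.
      rewrite (_ : f_ n @^-1` [set r] = set0) ?indic0 ?mulr0//.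
      by apply/seteqP; split=> // y yr; apply: nr; exists y.
  rewrite integralT_nnsfun sintegralE ge0_mule_fsumr.
    by apply: eq_fsbigr => r _; rewrite muleCA.
  move=> r; have [[y _ yr]|nr] := pselect (range (f_ n) r).
    by rewrite mule_ge0// -yr lee_fin.
  rewrite (_ : f_ n @^-1` [set r] = set0) ?measure0 ?mule0//.
  by apply/seteqP; split=> // y yr; apply: nr; exists y.
have H1 : (\int[mu]_t (H t * f_ n (Y t))%:E @[n --> \oo] --> \int[mu]_t (H t * f (Y t))%:E)%E.
  rewrite [X in _ --> X](_ : _ = \int[mu]_t limn (fun n => (H t * f_ n (Y t))%:E))%E.
    apply: cvg_monotone_convergence => //.
    - by move=> n; apply/measurable_EFinP; exact: (measurable_funM mH (mfY n)).
    - by move=> n t _; rewrite lee_fin mulr_ge0.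
    - by move=> t _ m n mn; rewrite lee_fin ler_wpM2l //; exact: f_nd.
  apply: eq_integral => t _; apply/esym/cvg_lim => //.
  rewrite EFinM; under eq_fun do rewrite EFinM.
  by apply: cvgeZl => //; exact: f_cvg.
have H2 : (c%:E * \int[nu]_y (f_ n y)%:E @[n --> \oo] --> c%:E * \int[nu]_y (f y)%:E)%E.
  apply: cvgeZl => //.
  rewrite [X in _ --> X](_ : _ = \int[nu]_y limn (fun n => (f_ n y)%:E))%E.
    apply: cvg_monotone_convergence => //.
    - by move=> n; exact/measurable_EFinP.
    - by move=> n t _; rewrite lee_fin.
    - by move=> t _ m n mn; rewrite lee_fin f_nd.
  by apply: eq_integral => t _; apply/esym/cvg_lim => //; exact: f_cvg.
have E : (fun n => \int[mu]_t (H t * f_ n (Y t))%:E)%E =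
    (fun n => c%:E * \int[nu]_y (f_ n y)%:E)%E by exact/funext.
rewrite E in H1.
exact: (cvg_unique (@ereal_hausdorff R) H1 H2).
Qed.

End WeightedTransfer.

Section GaussianIntegrals.
Context {R : realType} d {Omega : measurableType d} (P : probability Omega R).

Lemma integral_standard_gaussian (X : {RV P >-> R}) (f : R -> R) :
  standard_gaussian X -> measurable_fun setT f -> (forall x, 0 <= f x) ->
  (\int[P]_t (f (X t))%:E =
   \int[lebesgue_measure]_x (normal_pdf 0 1 x * f x)%:E)%E.
Proof.
move=> gX mf f0; transitivity (\int[distribution P X]_x (f x)%:E)%E.
  by rewrite ge0_integral_distribution//; exact/measurable_EFinP.
rewrite (@ge0_weighted_transfer _ _ _ _ R lebesgue_measure
  (distribution P X) (normal_pdf 0 1) (fun x => x) 1) ?mul1e//.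
- exact: measurable_normal_pdf.
- by move=> x; exact: normal_pdf_ge0.
- move=> B mB; rewrite mul1e; transitivity (normal_prob 0 1 B); last exact/esym/gX.
  rewrite /normal_prob [RHS]integral_mkcond.
  apply: eq_integral => x _; rewrite patchE indicE.
  by case: ifPn => xB; rewrite ?mulr1 ?mulr0.
Qed.

Lemma integral_expR_gaussian (X : {RV P >-> R}) (a : R) :
  standard_gaussian X ->
  (\int[P]_t (expR (a * X t))%:E = (expR (a ^+ 2 / 2))%:E)%E.
Proof.
move=> gX; rewrite (integral_standard_gaussian (f := fun x => expR (a * x)) gX); last 2 first.
- by apply: measurableT_comp => //; exact: measurable_funM.
- by move=> x; exact: expR_ge0.
transitivity (\int[lebesgue_measure]_x ((expR (a ^+ 2 / 2))%:E * (normal_pdf a 1 x)%:E))%E.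
  (* Completing the square: the exponential tilts the standard density into the one with mean
     [a]. *)
  apply: eq_integral => x _; rewrite -EFinM !normal_pdfE ?oner_neq0//.
  rewrite /normal_fun !mulrA [expR _ * _]mulrC -!mulrA -!expRD.
  congr (_ * expR _)%:E; rewrite subr0 expr1n; by field.
rewrite ge0_integralZl_EFin ?expR_ge0//.
- by rewrite integral_normal_pdf mule1.
- by move=> x _; rewrite lee_fin normal_pdf_ge0.
- by apply/measurable_EFinP; exact: measurable_normal_pdf.
Qed.

End GaussianIntegrals.

(** * Product formula for independent variables *)

Section Independence.
Context {R : realType} d {Omega : measurableType d} (P : probability Omega R).
Variable g : nat -> {RV P >-> R}.
Hypothesis indep_g : independent_sequence g.

Definition integral_of (f : nat -> R -> R) i := (\int[P]_t (f i (g i t))%:E)%E.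

(** Independence is the case of indicators. The induction frees one factor at a time: with the other
    factors kept as a weight, [g k] is transferred from indicators to a general function. *)
Lemma integral_prod_indep n (f : nat -> R -> R) :
  (forall i, measurable_fun setT (f i)) -> (forall i x, 0 <= f i x) ->
  (forall i, (integral_of f i < +oo)%E) ->
  (\int[P]_t (\prod_(i < n) f i (g i t))%:E =
   (\prod_(i < n) fine (integral_of f i))%:E)%E.
Proof.
have mcomp (h : R -> R) i : measurable_fun setT h -> measurable_fun setT (h \o g i).
  by move=> mh; exact: measurableT_comp.
have mpre i B : measurable B -> measurable (g i @^-1` B).
  by move=> mB; rewrite -[X in measurable X]setTI; exact: measurable_funP.
have Plt i B : measurable B -> (P (g i @^-1` B) < +oo)%E.
  by move=> mB; rewrite -ge0_fin_numE// fin_num_measure//; exact: mpre.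
have ind_int i B : measurable B -> (\int[P]_t (\1_B (g i t))%:E = P (g i @^-1` B))%E.
  move=> mB; transitivity (\int[P]_t (\1_(g i @^-1` B) t)%:E)%E; first exact: eq_integral.
  by rewrite integral_indic ?setIT//; exact: mpre.
(* The first [k] functions are arbitrary and the later ones are indicators. Functions of index at
   least [n] do not occur in the product, so they can be reset to the indicator of the whole
   line. *)
suff H k : forall f : nat -> R -> R,
    (forall i, measurable_fun setT (f i)) -> (forall i x, 0 <= f i x) ->
    (forall i, (integral_of f i < +oo)%E) ->
    (forall i, (k <= i)%N -> exists2 B, measurable B & f i = \1_B) ->
    (\int[P]_t (\prod_(i < n) f i (g i t))%:E =
     (\prod_(i < n) fine (integral_of f i))%:E)%E.
  move=> mf f0 ff.
  pose f' i := if (i < n)%N then f i else \1_setT.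
  have := H n f'.
  have -> : (fun t => (\prod_(i < n) f' i (g i t))%:E) = (fun t => (\prod_(i < n) f i (g i t))%:E).
    apply/funext => t; congr EFin; apply: eq_bigr => i _.
    by rewrite /f' ltn_ord.
  have -> : \prod_(i < n) fine (integral_of f' i) = \prod_(i < n) fine (integral_of f i).
    by apply: eq_bigr => i _; rewrite /integral_of /f' ltn_ord.
  apply.
  - by move=> i; rewrite /f'; case: ifP => // _; exact: measurable_indic.
  - by move=> i x; rewrite /f'; case: ifP.
  - move=> i; rewrite /integral_of /f'; case: ifP => [_|_]; first exact: ff.
    by rewrite ind_int//; exact: Plt.
  - by move=> i; rewrite leqNgt /f' => /negPf ->; exists setT.
elim: k => [|k IH] {}f mf f0 ff fB.
  have [B HB] := choice (fun i => let: ex_intro2 B p q := fB i (leq0n i) in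
    ex_intro (fun B => measurable B /\ f i = \1_B) B (conj p q)).
  have fE i : integral_of f i = P (g i @^-1` B i).
    by rewrite /integral_of (HB i).2 ind_int//; exact: (HB i).1.
  pose J := [fset i in iota 0 n]%fset.
  have JE : perm_eq J (index_iota 0 n).
    apply: uniq_perm; [exact: fset_uniq|exact: iota_uniq|].
    by move=> i; rewrite /index_iota subn0 !inE.
  transitivity (P (\bigcap_(j in [set` J]) (g j @^-1` B j))).
    have mcap : measurable (\bigcap_(j in [set` J]) (g j @^-1` B j)).
      by apply: fin_bigcap_measurable => // j _; apply: mpre; exact: (HB j).1.
    rewrite -[in RHS](setIT (\bigcap_(j in _) _)) -integral_indic//.
    apply: eq_integral => t _; rewrite indicE; congr EFin.
    have [/set_mem tB|/negP tB] := boolP (t \in _).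
      rewrite big1// => i _; rewrite (HB i).2 indicE mem_set//.
      by apply: (tB i); rewrite /= !inE mem_iota /= add0n ltn_ord.
    have [i ti] : exists i : 'I_n, ~ B i (g i t).
      apply: contrapT => /forallNP tBi; apply/tB/mem_set => i /=.
      rewrite !inE mem_iota /= add0n => ilt.
      by apply: contrapT => /(tBi (Ordinal ilt)).
    by rewrite (bigD1 i)//= (HB i).2 indicE memNset// mul0r.
  rewrite (indep_g J (fun j => (HB j).1)) (perm_big _ JE) /= big_mkord.
  rewrite (big_morph EFin EFinM (erefl : 1%:E = 1%E)).
  apply: eq_bigr => i _; rewrite fE fineK// fin_num_measure//.
  by apply: mpre; exact: (HB i).1.
have [nk|kn] := leqP n k.
  pose f' i := if (i == k) then \1_setT else f i.
  have := IH f'.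
  have -> : (fun t => (\prod_(i < n) f' i (g i t))%:E) = (fun t => (\prod_(i < n) f i (g i t))%:E).
    apply/funext => t; congr EFin; apply: eq_bigr => i _.
    by rewrite /f' ltn_eqF// (leq_trans (ltn_ord i)).
  have -> : \prod_(i < n) fine (integral_of f' i) = \prod_(i < n) fine (integral_of f i).
    apply: eq_bigr => i _.
    by rewrite /integral_of /f' ltn_eqF// (leq_trans (ltn_ord i)).
  apply.
  - by move=> i; rewrite /f'; case: ifP => // _; exact: measurable_indic.
  - by move=> i x; rewrite /f'; case: ifP.
  - move=> i; rewrite /integral_of /f'; case: ifP => [_|_]; last exact: ff.
    by rewrite ind_int//; exact: Plt.
  - move=> i ki; rewrite /f'; case: eqP => [_|/eqP ik]; first by exists setT.
    by apply: fB; rewrite ltn_neqAle eq_sym ik.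
pose H t := \prod_(i < n | i != Ordinal kn) f i (g i t).
pose c := \prod_(i < n | i != Ordinal kn) fine (integral_of f i).
have int0 i : (0 <= integral_of f i)%E.
  by apply: integral_ge0 => t _; rewrite lee_fin.
have := @ge0_weighted_transfer _ _ _ _ R P (distribution P (g k)) H (g k) c.
move=> /(_ _ _ _ _ (f k) (mf k) (f0 k)).
rewrite [X in (c%:E * X)%E](_ : _ = integral_of f k); last first.
  rewrite /integral_of ge0_integral_distribution//; first by apply: (measurableT_comp _ (mf k)).
  by move=> y; rewrite lee_fin.
rewrite -(@fineK _ (integral_of f k)) ?ge0_fin_numE//.
rewrite (bigD1 (Ordinal kn))//= mulrC EFinM => <-.
- apply: eq_integral => t _; congr EFin.
  by rewrite (bigD1 (Ordinal kn))//= mulrC.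
- rewrite /H; under eq_fun do rewrite -big_filter.
  by apply: measurable_prod => i _; exact: mcomp.
- by move=> t; apply: prodr_ge0.
- exact: measurable_funP.
- move=> B mB.
  pose f' i := if (i == k) then \1_B else f i.
  have := IH f'.
  have fk : f' k = \1_B by rewrite /f' eqxx.
  have fi i : i != k -> f' i = f i by rewrite /f' => /negPf ->.
  have -> : (fun t => (\prod_(i < n) f' i (g i t))%:E) = (fun t => (H t * \1_B (g k t))%:E).
    apply/funext => t; congr EFin; rewrite (bigD1 (Ordinal kn))//= fk mulrC.
    by congr (_ * _); apply: eq_bigr => i ik; rewrite fi.
  have -> : \prod_(i < n) fine (integral_of f' i) = c * fine (P (g k @^-1` B)).
    rewrite (bigD1 (Ordinal kn))//= mulrC; congr (_ * _).
      by apply: eq_bigr => i ik; rewrite /integral_of fi.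
    by rewrite /integral_of fk ind_int.
  move=> ->.
  + rewrite EFinM fineK// fin_num_measure//.
    by rewrite -[X in measurable X]setTI; exact: measurable_funP.
  + by move=> i; rewrite /f'; case: ifP => // _; exact: measurable_indic.
  + by move=> i x; rewrite /f'; case: ifP.
  + move=> i; rewrite /integral_of /f'; case: eqP => [->|_]; last exact: ff.
    by rewrite ind_int//; exact: Plt.
  + move=> i ki; rewrite /f'; case: eqP => [_|/eqP ik]; first by exists B.
    by apply: fB; rewrite ltn_neqAle eq_sym ik.
Qed.
End Independence.

Lemma max0_mul (R : realDomainType) (x y : R) :
  Num.max (x * y) 0 =
  Num.max x 0 * Num.max y 0 + Num.max (- x) 0 * Num.max (- y) 0.
Proof.
have pos (z : R) : 0 <= z -> ((Num.max z 0 = z) * (Num.max (- z) 0 = 0))%type.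
  by move=> z0; rewrite max_l// max_r// oppr_le0.
have neg (z : R) : z <= 0 -> ((Num.max z 0 = 0) * (Num.max (- z) 0 = - z))%type.
  by move=> z0; rewrite max_r// max_l// oppr_ge0.
have [x0|/ltW x0] := leP 0 x; have [y0|/ltW y0] := leP 0 y.
- rewrite !(pos _ x0) !(pos _ y0) mulr0 addr0.
  by rewrite (pos _ (mulr_ge0 x0 y0)).1.
- rewrite !(pos _ x0) !(neg _ y0) mulr0 mul0r addr0.
  by rewrite (neg _ (mulr_ge0_le0 x0 y0)).1.
- rewrite !(neg _ x0) !(pos _ y0) mulr0 mul0r addr0.
  by rewrite (neg _ (mulr_le0_ge0 x0 y0)).1.
- rewrite !(neg _ x0) !(neg _ y0) mulr0 add0r mulrNN.
  by rewrite (pos _ (mulr_le0 x0 y0)).1.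
Qed.

(** * Moments and orthogonality of Gaussian variables *)

Section GaussianMoments.
Context {R : realType} d {Omega : measurableType d} (P : probability Omega R).
Variable g : nat -> {RV P >-> R}.
Hypothesis hg : gaussian_sequence g.

Lemma integral_gaussian_eq i j (f : R -> R) :
  measurable_fun setT f -> (forall x, 0 <= f x) ->
  (\int[P]_t (f (g i t))%:E = \int[P]_t (f (g j t))%:E)%E.
Proof. by move=> mf f0; rewrite !integral_standard_gaussian//; exact: hg.2. Qed.

Lemma integral_gaussian_opp i (f : R -> R) :
  measurable_fun setT f -> (forall x, 0 <= f x) ->
  (\int[P]_t (f (- g i t))%:E = \int[P]_t (f (g i t))%:E)%E.
Proof.
move=> mf f0.
have mfN : measurable_fun setT (fun x : R => f (- x)) by exact: measurableT_comp.
rewrite (integral_standard_gaussian (f := fun x => f (- x)) (hg.2 i) mfN)//.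
rewrite integral_standard_gaussian//; last exact: hg.2.
have := @ge0_weighted_transfer _ _ _ _ R lebesgue_measure lebesgue_measure
  (cst 1) (-%R : _ -> measurableTypeR R) 1.
move=> /(_ _ _ _ _ (fun x => normal_pdf 0 1 x * f x)).
rewrite mul1e => <-//.
- apply: eq_integral => x _; rewrite mul1r !normal_pdfE ?oner_neq0//.
  by rewrite /normal_fun !subr0 sqrrN.
- move=> B mB; rewrite mul1e -[RHS]lebesgue_measureN//.
  under eq_integral do rewrite mul1r.
  transitivity (\int[lebesgue_measure]_t
    (\1_((-%R : _ -> measurableTypeR R) @^-1` B) t : R)%:E)%E; first exact: eq_integral.
  rewrite integral_indic ?setIT//.
  rewrite -[X in measurable X]setTI.
  by apply: oppr_measurable.
- apply: measurable_funM => //; exact: measurable_normal_pdf.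
- by move=> x; rewrite mulr_ge0// normal_pdf_ge0.
Qed.

Lemma integral_expR_comb n (a : 'I_n -> R) (l : R) :
  (\int[P]_t (expR (l * \sum_(i < n) a i * g i t))%:E =
   (expR (l ^+ 2 / 2 * \sum_(i < n) a i ^+ 2))%:E)%E.
Proof.
pose b k := if insub k is Some i then l * a i else 0.
have bE (i : 'I_n) : b i = l * a i by rewrite /b; case: insubP => [j _ /val_inj ->|/negP[]].
pose f k x := expR (b k * x).
have fint k : integral_of g f k = (expR (b k ^+ 2 / 2))%:E.
  by rewrite /integral_of integral_expR_gaussian//; exact: hg.2.
have := @integral_prod_indep _ _ _ P g hg.1 n f.
rewrite (_ : (fun t => _) = (fun t => (expR (l * \sum_(i < n) a i * g i t))%:E)).
  move=> ->.
  - congr EFin; rewrite mulr_sumr expR_sum; apply: eq_bigr => i _.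
    by rewrite fint /= bE; congr expR; field.
  - by move=> k; apply: measurableT_comp => //; exact: measurable_funM.
  - by move=> k x; exact: expR_ge0.
  - by move=> k; rewrite fint ltry.
apply/funext => t; congr EFin; rewrite mulr_sumr expR_sum; apply: eq_bigr => i _.
by rewrite /f bE mulrA.
Qed.

Lemma measurable_comb n (a : 'I_n -> R) :
  measurable_fun setT (fun t => \sum_(i < n) a i * g i t).
Proof. by apply: measurable_sum => i; exact: measurable_funM. Qed.

(** The exponential of [l |G|] is at most the sum of those of [l G] and [- l G], hence the factor
    2. *)
Lemma integral_expR_abs_comb n (a : 'I_n -> R) (l : R) :
  0 <= l -> \sum_(i < n) a i ^+ 2 <= 1 ->
  (\int[P]_t (expR (l * `|\sum_(i < n) a i * g i t|))%:E <=
   (2 * expR (l ^+ 2 / 2))%:E)%E.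
Proof.
move=> l0 a1.
have mG := measurable_comb a.
have mE c : measurable_fun setT (fun t => (expR (c * \sum_(i < n) a i * g i t))%:E).
  apply/measurable_EFinP; apply: measurableT_comp => //; exact: measurable_funM.
apply: (@le_trans _ _ (\int[P]_t ((expR (l * \sum_(i < n) a i * g i t))%:E +
    (expR (- l * \sum_(i < n) a i * g i t))%:E)))%E.
  apply: ge0_le_integral => //.
  - apply/measurable_EFinP; apply: measurableT_comp => //.
    by apply: measurable_funM => //; exact: measurableT_comp.
  - by apply: emeasurable_funD.
  - move=> t _; rewrite -EFinD lee_fin.
    have [_|_] := ger0P (\sum_(i < n) a i * g i t).
      by rewrite lerDl expR_ge0.
    by rewrite mulrN mulNr lerDr expR_ge0.
rewrite ge0_integralD//; try by move=> t _; rewrite lee_fin expR_ge0.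
rewrite !integral_expR_comb -EFinD sqrrN lee_fin mulr2n mulrDl mul1r.
have h : expR (l ^+ 2 / 2 * \sum_(i < n) a i ^+ 2) <= expR (l ^+ 2 / 2).
  by rewrite ler_expR ler_piMr// divr_ge0// sqr_ge0.
exact: lerD.
Qed.

Lemma sqr_le_expR (x : R) : x ^+ 2 <= 4 * expR (`|x|).
Proof.
have h : 1 + `|x| / 2 <= expR (`|x| / 2) by exact: expR_ge1Dx.
have -> : `|x| = `|x| / 2 + `|x| / 2 by field.
rewrite expRD -[x ^+ 2]real_normK ?num_real//.
have := normr_ge0 x; nra.
Qed.

Lemma integral_gaussian_sqr_fin i : (\int[P]_t (g i t ^+ 2)%:E < +oo)%E.
Proof.
have H := @integral_expR_abs_comb i.+1 (fun j => (j == ord_max)%:R) 1 ler01.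
apply: (@le_lt_trans _ _ (\int[P]_t (4%:E * (expR (`|g i t|))%:E)))%E.
  apply: ge0_le_integral => //.
  - by move=> t _; rewrite lee_fin sqr_ge0.
  - by apply/measurable_EFinP; exact: measurable_funX.
  - apply/measurable_EFinP; apply: measurable_funM => //.
    by apply: measurableT_comp => //; exact: measurableT_comp.
  - by move=> t _; rewrite -EFinM lee_fin sqr_le_expR.
rewrite ge0_integralZl_EFin//.
- apply: lte_mul_pinfty => //; apply: le_lt_trans (ltry _).
  rewrite (_ : (fun t => _) = fun t => (expR (`|g i t|))%:E) in H; last first.
    apply/funext => t; rewrite (bigD1 ord_max)//= eqxx !mul1r big1 ?addr0//.
    by move=> j; rewrite -val_eqE /= => /negPf ->; rewrite mul0r.
  apply: H; rewrite (bigD1 ord_max)//= eqxx expr1n big1 ?addr0// => j.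
  by rewrite -val_eqE /= => /negPf ->; rewrite expr0n.
- by apply/measurable_EFinP; apply: measurableT_comp => //; exact: measurableT_comp.
Qed.

(** The constant c of the overview, finite by comparison with an exponential moment. *)
Definition gauss_var : R := fine (\int[P]_t (g 0%N t ^+ 2)%:E)%E.

Lemma integral_gaussian_sqr i : (\int[P]_t (g i t ^+ 2)%:E = gauss_var%:E)%E.
Proof.
rewrite /gauss_var fineK.
  rewrite (integral_gaussian_eq i 0 (f := fun x => x ^+ 2))//.
  by move=> x; exact: sqr_ge0.
rewrite ge0_fin_numE; first exact: integral_gaussian_sqr_fin.
by apply: integral_ge0 => t _; rewrite lee_fin sqr_ge0.
Qed.

(** A zero second moment would make [g 0] vanish almost surely and give [expR (g 0)] the mean 1,
    against its value exp(1/2). *)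
Lemma gauss_var_gt0 : 0 < gauss_var.
Proof.
rewrite lt_def; apply/andP; split; last first.
  by rewrite fine_ge0// integral_ge0// => t _; rewrite lee_fin sqr_ge0.
apply/eqP => v0.
have : (\int[P]_t `|(g 0%N t ^+ 2)%:E| = 0)%E.
  under eq_integral do rewrite abse_EFin ger0_norm ?sqr_ge0//.
  by rewrite integral_gaussian_sqr v0.
move/ae_eq_integral_abs => /(_ measurableT _).
have mg2 : measurable_fun setT (fun t => (g 0%N t ^+ 2)%:E).
  by apply/measurable_EFinP; exact: measurable_funX.
move=> /(_ mg2) g0.
have : (\int[P]_t (expR (1 * g 0%N t))%:E = \int[P]_t (cst 1%E) t)%E.
  apply: ae_eq_integral => //.
    by apply/measurable_EFinP; apply: measurableT_comp => //; exact: measurable_funM.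
  apply: filterS g0 => t /= /(_ I) [/eqP]; rewrite sqrf_eq0 => /eqP -> _.
  by rewrite mulr0 expR0.
rewrite integral_expR_gaussian; last exact: hg.2.
rewrite integral_cst//= probability_setT mule1 => -[e1].
by have := expR_ge1Dx (1 ^+ 2 / 2 : R); rewrite e1 expr1n; lra.
Qed.

Lemma integral_mul_indep i j (h k : R -> R) : i != j ->
  measurable_fun setT h -> measurable_fun setT k ->
  (forall x, 0 <= h x) -> (forall x, 0 <= k x) ->
  (\int[P]_t (h (g i t))%:E < +oo)%E -> (\int[P]_t (k (g j t))%:E < +oo)%E ->
  (\int[P]_t (h (g i t) * k (g j t))%:E =
   (fine (\int[P]_t (h (g i t))%:E) * fine (\int[P]_t (k (g j t))%:E))%:E)%E.
Proof.
move=> ij mh mk h0 k0 hf kf.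
pose f l : R -> R := if l == i then h else if l == j then k else cst 1.
have int1 l : (\int[P]_t ((cst 1 : R -> R) (g l t))%:E = 1)%E.
  transitivity (\int[P]_t (cst 1%E) t)%E => //.
  by rewrite integral_cst//= probability_setT mule1.
have fi : f i = h by rewrite /f eqxx.
have fj : f j = k by rewrite /f eqxx eq_sym (negPf ij).
have fo l : l != i -> l != j -> f l = cst 1 by rewrite /f => /negPf -> /negPf ->.
have ilt : (i < (i + j).+1)%N by rewrite ltnS leq_addr.
have jlt : (j < (i + j).+1)%N by rewrite ltnS leq_addl.
have := @integral_prod_indep _ _ _ P g hg.1 (i + j).+1 f.
have -> : (fun t => (\prod_(l < (i + j).+1) f l (g l t))%:E) =
    (fun t => (h (g i t) * k (g j t))%:E).
  apply/funext => t; congr EFin.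
  rewrite (bigD1 (Ordinal ilt))//= (bigD1 (Ordinal jlt))/=; last first.
    by rewrite -val_eqE /= eq_sym.
  rewrite fi fj big1 ?mulr1// => l /andP[li lj].
  by rewrite fo.
have -> : \prod_(l < (i + j).+1) fine (integral_of g f l) =
    fine (\int[P]_t (h (g i t))%:E) * fine (\int[P]_t (k (g j t))%:E).
  rewrite (bigD1 (Ordinal ilt))//= (bigD1 (Ordinal jlt))/=; last first.
    by rewrite -val_eqE /= eq_sym.
  rewrite /integral_of fi fj big1 ?mulr1// => l /andP[li lj].
  by rewrite fo// int1.
apply.
- by move=> l; rewrite /f; case: ifP => // _; case: ifP.
- by move=> l x; rewrite /f; case: ifP => // _; case: ifP.
- move=> l; rewrite /integral_of /f; case: eqP => [->//|_]; case: eqP => [->//|_].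
  by rewrite int1 ltry.
Qed.

Lemma gaussian_Lfun2 i : (g i : Omega -> R) \in Lfun P 2%:E.
Proof.
rewrite inE; apply/andP; split; first by rewrite inE; exact: measurable_funP.
rewrite inE /finite_norm unlock /= poweR_lty//.
rewrite (_ : integral _ _ _ = \int[P]_t (g i t ^+ 2)%:E)%E.
  exact: integral_gaussian_sqr_fin.
apply: eq_integral => t _; rewrite /= powR_mulrn//.
by rewrite real_normK// num_real.
Qed.

(** The product formula covers nonnegative functions, so for distinct indices both variables are
    split into positive and negative parts. By symmetry these parts have the same mean, and the four
    products cancel. *)
Lemma expectation_gaussian_mul i j :
  ('E_P[(g i : Omega -> R) \* g j] = ((i == j)%:R * gauss_var)%:E)%E.
Proof.
have [->|ij] := eqVneq i j.
  rewrite mul1r unlock -(integral_gaussian_sqr j).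
  by apply: eq_integral => t _; rewrite expr2.
rewrite mul0r unlock.
pose p x : R := Num.max x 0; pose m x : R := Num.max (- x) 0.
have mp : measurable_fun setT p by exact: measurable_maxr.
have mm : measurable_fun setT m.
  by apply: measurable_maxr => //; exact: oppr_measurable.
have p0 x : 0 <= p x by rewrite le_max lexx orbT.
have m0 x : 0 <= m x by rewrite le_max lexx orbT.
have ple x : p x <= 1 + x ^+ 2.
  by rewrite ge_max; apply/andP; split; nra.
have pf l : (\int[P]_t (p (g l t))%:E < +oo)%E.
  apply: (@le_lt_trans _ _ (\int[P]_t (1 + (g l t ^+ 2)%:E)))%E.
    apply: ge0_le_integral => //.
    - by move=> t _; rewrite lee_fin.
    - by apply/measurable_EFinP; exact: measurableT_comp.
    - by apply: emeasurable_funD => //; apply/measurable_EFinP; exact: measurable_funX.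
    - by move=> t _; rewrite -EFinD lee_fin.
  rewrite ge0_integralD//; last 2 first.
  - by move=> t _; rewrite lee_fin sqr_ge0.
  - by apply/measurable_EFinP; exact: measurable_funX.
  have -> : (\int[P]_t (1 : \bar R) = 1)%E.
    by rewrite integral_cst//= probability_setT mule1.
  rewrite integral_gaussian_sqr.
  by rewrite -EFinD ltry.
have mE l : (\int[P]_t (m (g l t))%:E = \int[P]_t (p (g l t))%:E)%E.
  rewrite -(integral_gaussian_opp l mp p0).
  by apply: eq_integral => t _.
have mf l : (\int[P]_t (m (g l t))%:E < +oo)%E by rewrite mE.
have mpg l : measurable_fun setT (fun t => p (g l t)) by exact: measurableT_comp.
have mmg l : measurable_fun setT (fun t => m (g l t)) by exact: measurableT_comp.
have split_int (F1 F2 : Omega -> R) : measurable_fun setT F1 -> measurable_fun setT F2 ->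
    (forall t, 0 <= F1 t) -> (forall t, 0 <= F2 t) ->
    (\int[P]_t (F1 t + F2 t)%:E = \int[P]_t (F1 t)%:E + \int[P]_t (F2 t)%:E)%E.
  move=> mF1 mF2 F10 F20; under eq_integral do rewrite EFinD.
  by rewrite ge0_integralD//; [move=> t _; rewrite lee_fin | exact/measurable_EFinP |
    move=> t _; rewrite lee_fin | exact/measurable_EFinP].
rewrite integralE.
rewrite [X in (X - _)%E](_ : _ =
    \int[P]_t (p (g i t) * p (g j t) + m (g i t) * m (g j t))%:E)%E; last first.
  apply: eq_integral => t _; rewrite funeposE /= -EFin_max; congr EFin.
  exact: max0_mul.
rewrite [X in (_ - X)%E](_ : _ =
    \int[P]_t (p (g i t) * m (g j t) + m (g i t) * p (g j t))%:E)%E; last first.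
  apply: eq_integral => t _; rewrite funenegE /= -EFin_max; congr EFin.
  by rewrite -mulrN max0_mul opprK.
rewrite !split_int//; try exact: measurable_funM; try by move=> t; exact: mulr_ge0.
rewrite !integral_mul_indep// !mE -EFinN -!EFinD; congr EFin; ring.
Qed.

End GaussianMoments.

(** * Gaussian sums in L2 *)

Section StronglyMeasurable.
Context {R : realType} d {Omega : measurableType d}.

Import HBSimple.

Lemma simple_function_op (A B C : normedModType R) (op : A -> B -> C)
    (s : Omega -> A) (s' : Omega -> B) :
  simple_function s -> simple_function s' ->
  simple_function (fun t => op (s t) (s' t)).
Proof.
move=> [fs ms] [fs' ms']; split.
  apply: (@sub_finite_set _ _ ((fun p => op p.1 p.2) @` (range s `*` range s'))).
    by move=> _ [t _ <-]; exists (s t, s' t).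
  by apply: finite_image; exact: finite_setX.
move=> z.
rewrite (_ : _ @^-1` _ = \bigcup_(p in (range s `*` range s') `&` [set p | op p.1 p.2 = z])
    (s @^-1` [set p.1] `&` s' @^-1` [set p.2])).
  apply: fin_bigcup_measurable; first exact/finite_setIl/finite_setX.
  by move=> p _; exact: measurableI.
apply/seteqP; split=> [t <-|t [[a b] /= [_ <-] [-> ->]]]//=.
by exists (s t, s' t).
Qed.

Lemma strongly_measurable_op (A B C : normedModType R) (op : A -> B -> C)
    (S : Omega -> A) (S' : Omega -> B) :
  (forall (u : nat -> A) (v : nat -> B) a b,
    u @ \oo --> a -> v @ \oo --> b -> (fun k => op (u k) (v k)) @ \oo --> op a b) ->
  strongly_measurable S -> strongly_measurable S' ->
  strongly_measurable (fun t => op (S t) (S' t)).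
Proof.
move=> cop [s [ss sS]] [s' [ss' sS']]; exists (fun k t => op (s k t) (s' k t)); split.
  by move=> k; exact: simple_function_op.
by move=> t; apply: cop.
Qed.

Lemma strongly_measurable_cst (A : normedModType R) (a : A) :
  strongly_measurable (cst a : Omega -> A).
Proof.
exists (fun _ => cst a); split; last by move=> t; exact: cvg_cst.
move=> _; split.
  apply: (@sub_finite_set _ _ [set a]); last exact: finite_set1.
  by move=> _ [t _ <-].
move=> z; have [->|az] := eqVneq a z.
  rewrite (_ : _ @^-1` _ = setT)//; exact/seteqP.
rewrite (_ : _ @^-1` _ = set0)//; apply/seteqP; split=> // t /= e.
by move/eqP: az; exact.
Qed.

Lemma strongly_measurable_mfun (h : Omega -> R) :
  measurable_fun setT h -> @strongly_measurable R d Omega R^o h.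
Proof.
move=> mh; pose hE : Omega -> \bar R := EFin \o h.
have mhE : measurable_fun setT hE by exact/measurable_EFinP.
have [s sh] := approximation_sfun measurableT mhE.
exists (fun k => s k); split.
  move=> k; split; first exact: fimfunP.
  by move=> z; rewrite -[X in measurable X]setTI; exact: measurable_funP.
by move=> t; have := sh t I; move/fine_cvgP => [_].
Qed.

Lemma measurable_norm_simple (Z : normedModType R) (s : Omega -> Z) :
  simple_function s -> measurable_fun setT (fun t => `|s t|).
Proof.
move=> [fs ms] _ B mB; rewrite setTI.
rewrite (_ : _ @^-1` _ = \bigcup_(z in range s `&` [set z | B `|z|]) s @^-1` [set z]).
  by apply: fin_bigcup_measurable; [exact: finite_setIl|move=> z _; exact: ms].
apply/seteqP; split=> [t Bt|t [z [_ Bz] /= ->]]//.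
by exists (s t).
Qed.

Lemma strongly_measurable_norm (Z : normedModType R) (S : Omega -> Z) :
  strongly_measurable S -> measurable_fun setT (fun t => `|S t|).
Proof.
move=> [s [ss sS]]; apply: (@measurable_fun_cvg _ _ _ _ (fun k t => `|s k t|)).
  by move=> k; exact: measurable_norm_simple.
by move=> t _; apply: cvg_norm; exact: sS.
Qed.

Lemma strongly_measurableD (Z : normedModType R) (S S' : Omega -> Z) :
  strongly_measurable S -> strongly_measurable S' ->
  strongly_measurable (fun t => S t + S' t).
Proof.
move=> mS mS'; apply: (strongly_measurable_op (op := fun a b : Z => a + b)) => //.
by move=> u v a b; exact: cvgD.
Qed.

Lemma strongly_measurableB (Z : normedModType R) (S S' : Omega -> Z) :
  strongly_measurable S -> strongly_measurable S' ->
  strongly_measurable (fun t => S t - S' t).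
Proof.
move=> mS mS'; apply: (strongly_measurable_op (op := fun a b : Z => a - b)) => //.
by move=> u v a b; exact: cvgB.
Qed.

Lemma strongly_measurable_scale (Z : normedModType R) (h : Omega -> R) (z : Z) :
  measurable_fun setT h -> strongly_measurable (fun t => h t *: z).
Proof.
move=> mh; apply: (@strongly_measurable_op R^o Z Z (fun a z => (a : R) *: z) h (cst z)).
- by move=> u v a b; exact: cvgZ.
- exact: strongly_measurable_mfun.
- exact: strongly_measurable_cst.
Qed.

End StronglyMeasurable.

Section L2Norm.
Context {R : realType} d {Omega : measurableType d} (P : probability Omega R).

Lemma Lnorm2_le (h h' : Omega -> R) :
  measurable_fun setT h -> measurable_fun setT h' ->
  (forall t, `|h t| <= `|h' t|) ->
  (Lnorm P 2%:E (EFin \o h) <= Lnorm P 2%:E (EFin \o h'))%E.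
Proof.
move=> mh mh' hh'; rewrite unlock gt0_ler_poweR//.
- by rewrite in_itv/= leey integral_ge0// => t _; exact: poweR_ge0.
- by rewrite in_itv/= leey integral_ge0// => t _; exact: poweR_ge0.
have mp (k : Omega -> R) : measurable_fun setT k ->
    measurable_fun setT (fun t => (`|(EFin \o k) t| `^ 2)%E).
  move=> mk; under eq_fun do rewrite /=.
  apply/measurable_EFinP.
  apply: (@measurableT_comp _ _ _ _ _ _ (fun x : R => x `^ 2)) => //.
  exact: measurableT_comp.
apply: ge0_le_integral => //; try exact: mp.
- by move=> t _; exact: poweR_ge0.
- by move=> t _; rewrite /= lee_fin ge0_ler_powR// nnegrE.
Qed.

Section Vector.
Context {Z : normedModType R}.
Implicit Types S : Omega -> Z.

Lemma L2normD S S' : strongly_measurable S -> strongly_measurable S' ->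
  (L2norm P (fun t => S t + S' t)%R <= L2norm P S + L2norm P S')%E.
Proof.
move=> mS mS'.
apply: le_trans (minkowski_EFin P (strongly_measurable_norm mS)
  (strongly_measurable_norm mS') _); last by rewrite ler1n.
apply: Lnorm2_le.
- exact/strongly_measurable_norm/strongly_measurableD.
- by apply: measurable_funD; exact: strongly_measurable_norm.
- by move=> t; rewrite normr_id [leRHS]ger0_norm ?addr_ge0// ler_normD.
Qed.

Lemma L2norm_sqrt S (r : R) :
  (\int[P]_t (`|S t| ^+ 2)%:E = r%:E)%E -> L2norm P S = (Num.sqrt r)%:E.
Proof.
move=> Sr; rewrite /L2norm unlock.
have r0 : 0 <= r.
  by rewrite -lee_fin -Sr integral_ge0// => t _; rewrite lee_fin sqr_ge0.
rewrite (_ : integral _ _ _ = r%:E); first by rewrite /= powR12_sqrt.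
by rewrite -Sr; apply: eq_integral => t _; rewrite /= powR_mulrn// normr_id.
Qed.

Lemma L2norm_le_sqr S (c : R) : 0 <= c ->
  (\int[P]_t (`|S t| ^+ 2)%:E <= (c ^+ 2)%:E)%E -> (L2norm P S <= c%:E)%E.
Proof.
move=> c0 Sc.
have I0 : (0 <= \int[P]_t (`|S t| ^+ 2)%:E)%E.
  by rewrite integral_ge0// => t _; rewrite lee_fin sqr_ge0.
have If : (\int[P]_t (`|S t| ^+ 2)%:E)%E \is a fin_num.
  by rewrite ge0_fin_numE// (le_lt_trans Sc)// ltry.
rewrite (L2norm_sqrt (esym (fineK If))) lee_fin -(ger0_norm c0) -sqrtr_sqr.
by rewrite ler_wsqrtr// -lee_fin fineK.
Qed.

Lemma L2normZ S (a : R) : strongly_measurable S -> (L2norm P S < +oo)%E ->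
  L2norm P (fun t => a *: S t) = (`|a|%:E * L2norm P S)%E.
Proof.
move=> mS Sf.
have I0 : (0 <= \int[P]_t (`|S t| ^+ 2)%:E)%E.
  by rewrite integral_ge0// => t _; rewrite lee_fin sqr_ge0.
have If : (\int[P]_t (`|S t| ^+ 2)%:E)%E \is a fin_num.
  rewrite ge0_fin_numE//; move: Sf; rewrite /L2norm => /(poweR_lty 2).
  rewrite powR_Lnorm//.
  under eq_integral do rewrite /= powR_mulrn// normr_id.
  exact.
rewrite (L2norm_sqrt (esym (fineK If))) -EFinM -sqrtr_sqr -sqrtrM ?sqr_ge0//.
apply: L2norm_sqrt; rewrite EFinM fineK//.
rewrite -ge0_integralZl_EFin ?sqr_ge0//.
- apply: eq_integral => t _; rewrite -EFinM normrZ exprMn.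
  by rewrite (real_normK (num_real a)).
- by apply/measurable_EFinP; apply: measurable_funX; exact: strongly_measurable_norm.
Qed.

End Vector.
End L2Norm.

(** The weighted second moment about [S / B] is nonnegative; expanding it, with the total mass
    bounded by [B], gives this Cauchy-Schwarz inequality. *)
Lemma weighted_sum_sqr_le (R : realFieldType) n (mu e : 'I_n -> R) (B : R) :
  (forall k, 0 <= mu k) -> 0 < B -> \sum_k mu k <= B ->
  (\sum_k mu k * e k) ^+ 2 <= B * \sum_k mu k * e k ^+ 2.
Proof.
move=> mu0 B0 muB; set S := \sum_k mu k * e k.
have : 0 <= \sum_k mu k * (e k - S / B) ^+ 2.
  by apply: sumr_ge0 => k _; rewrite mulr_ge0// sqr_ge0.
have -> : \sum_k mu k * (e k - S / B) ^+ 2 =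
    \sum_k mu k * e k ^+ 2 - 2 * (S / B) * S + (S / B) ^+ 2 * \sum_k mu k.
  by rewrite /S !mulr_sumr -sumrB -big_split /=; apply: eq_bigr => k _; ring.
have h : (S / B) ^+ 2 * \sum_k mu k <= (S / B) ^+ 2 * B by rewrite ler_wpM2l// sqr_ge0.
move=> h0.
have : 0 <= \sum_k mu k * e k ^+ 2 - S ^+ 2 / B.
  have -> : \sum_k mu k * e k ^+ 2 - S ^+ 2 / B =
      \sum_k mu k * e k ^+ 2 - 2 * (S / B) * S + (S / B) ^+ 2 * B.
    by field; rewrite gt_eqF.
  by lra.
by rewrite subr_ge0 ler_pdivrMr// mulrC.
Qed.

(** * Gaussian sums with vector coefficients *)

Section GaussianSums.
Context {R : realType} d {Omega : measurableType d} (P : probability Omega R).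
Variable g : nat -> {RV P >-> R}.
Hypothesis hg : gaussian_sequence g.

Definition gauss_sum {Z : normedModType R} n (w : nat -> Z) t : Z :=
  \sum_(i < n) g i t *: w i.

Definition gauss_norm {Z : normedModType R} n (w : nat -> Z) : R :=
  fine (L2norm P (gauss_sum n w)).

Section Vector.
Context {Z : normedModType R}.
Implicit Types w : nat -> Z.

Lemma gauss_sum_widen n N w t : (n <= N)%N -> (forall i, (n <= i)%N -> w i = 0) ->
  gauss_sum N w t = gauss_sum n w t.
Proof.
move=> nN w0; rewrite /gauss_sum (big_ord_widen _ (fun i => g i t *: w i) nN).
rewrite [LHS](bigID (fun i : 'I_N => (i < n)%N)) /=.
by rewrite [X in _ + X]big1 ?addr0// => i; rewrite -leqNgt => /w0 ->; rewrite scaler0.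
Qed.

Lemma eq_gauss_norm n w w' : (forall i, (i < n)%N -> w i = w' i) ->
  gauss_norm n w = gauss_norm n w'.
Proof.
move=> ww'; rewrite /gauss_norm (_ : gauss_sum n w = gauss_sum n w')//; apply/funext => t.
by apply: eq_bigr => i _; rewrite ww'.
Qed.

Lemma gauss_norm_widen n N w : (n <= N)%N -> (forall i, (n <= i)%N -> w i = 0) ->
  gauss_norm N w = gauss_norm n w.
Proof.
move=> nN w0; rewrite /gauss_norm (_ : gauss_sum N w = gauss_sum n w)//; apply/funext => t.
exact: gauss_sum_widen.
Qed.

Lemma strongly_measurable_gauss_sum n w : strongly_measurable (gauss_sum n w).
Proof.
elim: n => [|n IH].
  rewrite (_ : gauss_sum 0 w = cst 0); first exact: strongly_measurable_cst.
  by apply/funext => t; rewrite /gauss_sum big_ord0.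
rewrite (_ : gauss_sum n.+1 w = fun t => gauss_sum n w t + g n t *: w n).
  by apply: strongly_measurableD => //; exact: strongly_measurable_scale.
by apply/funext => t; rewrite /gauss_sum big_ord_recr.
Qed.

Lemma L2norm_gauss_sum_fin n w : (L2norm P (gauss_sum n w) < +oo)%E.
Proof.
elim: n => [|n IH].
  rewrite (@L2norm_sqrt _ _ _ P _ _ 0) ?ltry//.
  rewrite (eq_integral (cst 0%E)) ?integral0// => t _.
  by rewrite /gauss_sum big_ord0 normr0 expr0n.
rewrite (_ : gauss_sum n.+1 w = fun t => gauss_sum n w t + g n t *: w n); last first.
  by apply/funext => t; rewrite /gauss_sum big_ord_recr.
apply: le_lt_trans (L2normD _ _ _) _.
- exact: strongly_measurable_gauss_sum.
- exact: strongly_measurable_scale.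
rewrite lte_add_pinfty// (@L2norm_sqrt _ _ _ P _ _ (gauss_var g * `|w n| ^+ 2)) ?ltry//.
rewrite EFinM -(integral_gaussian_sqr hg n) muleC -ge0_integralZl_EFin ?sqr_ge0//.
- apply: eq_integral => t _; rewrite -EFinM normrZ exprMn mulrC.
  by rewrite (real_normK (num_real (g n t))).
- by move=> t _; rewrite lee_fin sqr_ge0.
- by apply/measurable_EFinP; exact: measurable_funX.
Qed.

Lemma gauss_normE n w : L2norm P (gauss_sum n w) = (gauss_norm n w)%:E.
Proof. by rewrite fineK// ge0_fin_numE ?L2norm_gauss_sum_fin// Lnorm_ge0. Qed.

Lemma gauss_norm_ge0 n w : 0 <= gauss_norm n w.
Proof. by rewrite fine_ge0// Lnorm_ge0. Qed.

Lemma gauss_normD n w w' : gauss_norm n (fun i => w i + w' i) <= gauss_norm n w + gauss_norm n w'.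
Proof.
rewrite -lee_fin EFinD -!gauss_normE.
apply: le_trans (L2normD _ (strongly_measurable_gauss_sum _ _) (strongly_measurable_gauss_sum _ _)).
rewrite (_ : gauss_sum n _ = fun t => gauss_sum n w t + gauss_sum n w' t)//.
apply/funext => t; rewrite /gauss_sum -big_split; apply: eq_bigr => i _ /=.
by rewrite scalerDr.
Qed.

Lemma gauss_normZ n (a : R) w : gauss_norm n (fun i => a *: w i) = `|a| * gauss_norm n w.
Proof.
apply: EFin_inj; rewrite EFinM -!gauss_normE.
rewrite -(L2normZ _ (strongly_measurable_gauss_sum _ _) (L2norm_gauss_sum_fin _ _)).
congr L2norm; apply/funext => t; rewrite /gauss_sum scaler_sumr; apply: eq_bigr => i _.
by rewrite !scalerA mulrC.
Qed.

End Vector.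

(** Two spaces are allowed so that vectors of [E] and [X], or functionals on them, can be compared
    at each [t]. *)
Lemma gauss_norm_le (Z Z' : normedModType R) n (w : nat -> Z) (w' : nat -> Z') :
  (forall t, `|gauss_sum n w t| <= `|gauss_sum n w' t|) -> gauss_norm n w <= gauss_norm n w'.
Proof.
move=> ww'; rewrite -lee_fin -!gauss_normE; apply: Lnorm2_le.
- exact/strongly_measurable_norm/strongly_measurable_gauss_sum.
- exact/strongly_measurable_norm/strongly_measurable_gauss_sum.
- by move=> t; rewrite !normr_id.
Qed.

(* With S = sum g_i f_i and W = sum g_i w_i, orthogonality of the g_i gives
   E <S, W> = gauss_var * sum <f_i, w_i>. *)
Lemma gauss_sum_duality (V : normedModType R) n (f : nat -> dual V) (w : nat -> V) :
  gauss_var g * \sum_(i < n) f i (w i) <= gauss_norm n f * gauss_norm n w.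
Proof.
pose h t : R := gauss_sum n f t (gauss_sum n w t).
(* The pairing of the two sums is expanded over pairs of indices. Products of two L2 functions are
   integrable, so the expectation can be taken term by term. *)
pose phi (p : 'I_n * 'I_n) : Omega -> R :=
  f p.1 (w p.2) \o* ((g p.1 : Omega -> R) \* g p.2).
have gg i j : (g i : Omega -> R) \* g j \in Lfun P 1.
  by apply: Lfun2_mul_Lfun1; exact: gaussian_Lfun2.
have phi1 p : phi p \in Lfun P 1 by apply: Lfun_scale; rewrite ?lexx.
have hE : h = \sum_(F <- [seq phi p | p <- enum {: 'I_n * 'I_n}]) F.
  rewrite big_map big_enum /= -[RHS]/(\sum_p phi p); apply/funext => t.
  rewrite fct_sumE -(pair_big xpredT xpredT (fun i j => phi (i, j) t)) /= /h /gauss_sum.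
  have ev : {morph (fun F : dual V => F (\sum_(j < n) g j t *: w j)) : F G / F + G} by [].
  rewrite (big_morph _ ev erefl); apply: eq_bigr => i _.
  rewrite linear_sum; apply: eq_bigr => j _.
  rewrite -[LHS]/(g i t * f i (g j t *: w j)) linearZ /= /phi /=.
  rewrite -[LHS]/(g i t * (g j t * f i (w j))); ring.
have h1 : h \in Lfun P 1.
  rewrite hE big_map big_enum /=; apply: rpred_sum => p _; exact: phi1.
have Eh : ('E_P[h] = (gauss_var g * \sum_(i < n) f i (w i))%:E)%E.
  rewrite hE expectation_sum; last by move=> F /mapP[p _ ->].
  rewrite big_map big_enum /=.
  transitivity (\sum_(p : 'I_n * 'I_n)
      (f p.1 (w p.2) * ((p.1 == p.2)%:R * gauss_var g))%:E)%E.
    apply: eq_bigr => p _; rewrite expectationZl// expectation_gaussian_mul//.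
  rewrite sumEFin; congr EFin.
  rewrite -(pair_big xpredT xpredT (fun i j : 'I_n => f i (w j) * ((i == j)%:R * gauss_var g))) /=.
  rewrite mulr_sumr; apply: eq_bigr => i _.
  rewrite (bigD1 i)//= eqxx big1 ?addr0; first by rewrite mul1r mulrC.
  by move=> j; rewrite eq_sym => /negPf ->; rewrite mul0r mulr0.
rewrite -lee_fin -Eh EFinM -!gauss_normE.
have mh : measurable_fun setT h.
  by move: h1; rewrite inE => /andP[+ _]; rewrite inE.
have mf := strongly_measurable_norm (strongly_measurable_gauss_sum n f).
have mw := strongly_measurable_norm (strongly_measurable_gauss_sum n w).
apply: le_trans (hoelder P mf mw _ _ _) => //; last by rewrite [RHS]splitr !div1r.
rewrite Lnorm1 unlock.
apply: (le_trans (lee_abs _)); apply: (le_trans (le_abse_integral _ _ _)) => //.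
  exact/measurable_EFinP.
apply: ge0_le_integral => //.
- by apply/measurable_EFinP; exact: measurableT_comp.
- apply/measurable_EFinP; apply: measurableT_comp => //; exact: measurable_funM.
- move=> t _; rewrite lee_fin /= [leRHS]ger0_norm ?mulr_ge0//.
  exact: (ler_opnorm (gauss_sum n f t)).
Qed.

Lemma gauss_norm_comb_le (X : normedModType R) : finite_cotype X ->
  exists2 C : R, 0 <= C & forall m (x : 'I_m -> X), weak_l1 x <= 1 ->
    forall n (a : 'I_m -> nat -> R), (forall k, \sum_(i < n) a k i ^+ 2 <= 1) ->
    gauss_norm n (fun i => \sum_k a k i *: x k) <= C.
Proof.
move=> /cotype_domination[N [B B0 H]].
have B1 : 0 < B + 1 by lra.
(* [D] bounds the mean of the exponential of [2 N |G k|]. [C2] combines [(2 + s)^2 <= 8 + 2 s^2]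
   with the weighted Cauchy-Schwarz inequality, where [B + 1] is a positive bound for the mass. *)
pose D := 2 * expR ((2 * N%:R) ^+ 2 / 2) : R.
have D0 : 0 <= D by rewrite mulr_ge0// expR_ge0.
pose C2 := 8 + 2 * (B + 1) * (B * D).
have C20 : 0 <= C2 by rewrite addr_ge0// !mulr_ge0// ltW.
exists (Num.sqrt C2); first exact: sqrtr_ge0.
move=> m x x1 n a a1.
have [mu [mu0 muB Hmu]] := H _ x x1.
rewrite -lee_fin -gauss_normE; apply: L2norm_le_sqr; first exact: sqrtr_ge0.
rewrite sqr_sqrtr//.
pose G k t := \sum_(i < n) a k i * g i t.
have mG k : measurable_fun setT (G k) by exact: (measurable_comb g).
pose e k t := expR (2 * N%:R * `|G k t|).
have me k : measurable_fun setT (e k).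
  apply: measurableT_comp => //; apply: measurable_funM => //.
  exact: measurableT_comp.
have mue0 k t : 0 <= mu k * e k t by rewrite mulr_ge0// expR_ge0.
have le t : `|gauss_sum n (fun i => \sum_k a k i *: x k) t| ^+ 2 <=
    8 + 2 * (B + 1) * \sum_k mu k * e k t.
  have -> : gauss_sum n (fun i => \sum_k a k i *: x k) t = \sum_k G k t *: x k.
    rewrite /gauss_sum; under eq_bigr => i _ do rewrite scaler_sumr.
    rewrite exchange_big; apply: eq_bigr => k _ /=; rewrite scaler_suml.
    by apply: eq_bigr => i _; rewrite scalerA mulrC.
  have := Hmu (fun k => G k t); set s := \sum_k mu k * _ => le1.
  have s2 : s ^+ 2 <= (B + 1) * \sum_k mu k * e k t.
    have muB1 : \sum_k mu k <= B + 1 by lra.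
    have := weighted_sum_sqr_le (fun k => expR (N%:R * `|G k t|)) mu0 B1 muB1.
    rewrite -/s; under [X in _ <= _ * X -> _]eq_bigr.
      move=> k _; rewrite -expRM_natl.
      rewrite (_ : 2%:R * (N%:R * `|G k t|) = 2 * N%:R * `|G k t|); last by rewrite mulrA.
      over.
    by [].
  apply: (@le_trans _ _ ((2 + s) ^+ 2)).
    by rewrite lerXn2r// nnegrE// (le_trans _ le1).
  have := sqr_ge0 (2 - s); lra.
apply: (@le_trans _ _ (\int[P]_t (8%:E + (2 * (B + 1))%:E * \sum_k (mu k * e k t)%:E)))%E.
  apply: ge0_le_integral => //.
  - apply/measurable_EFinP; apply: measurable_funX.
    exact/strongly_measurable_norm/strongly_measurable_gauss_sum.
  - apply: emeasurable_funD => //; apply: measurable_funeM.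
    by apply: emeasurable_sum => k; apply/measurable_EFinP; exact: measurable_funM.
  - by move=> t _; rewrite sumEFin -EFinM -EFinD lee_fin.
have mS : measurable_fun setT (fun t => (\sum_k (mu k * e k t)%:E)%E).
  by apply: emeasurable_sum => k; apply/measurable_EFinP; exact: measurable_funM.
have S0 t : (0 <= \sum_k (mu k * e k t)%:E)%E by rewrite sumEFin lee_fin sumr_ge0.
have B20 : 0 <= 2 * (B + 1) by lra.
rewrite ge0_integralD//; first last.
- by apply: measurable_funeM.
- by move=> t _; rewrite mule_ge0// lee_fin.
rewrite integral_cst//= probability_setT mule1 ge0_integralZl_EFin//.
rewrite ge0_integral_sum//; first last.
- by move=> k t _; rewrite lee_fin.
- by move=> k; apply/measurable_EFinP; exact: measurable_funM.
rewrite /C2 [leRHS]EFinD leeD2l// [leRHS]EFinM lee_wpmul2l ?lee_fin//.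
apply: (@le_trans _ _ (\sum_k (mu k * D)%:E)%E).
  apply: lee_sum => k _.
  rewrite (_ : integral _ _ _ = (mu k)%:E * \int[P]_t (e k t)%:E)%E; last first.
    rewrite -ge0_integralZl_EFin//; first by move=> t _; rewrite lee_fin expR_ge0.
    exact/measurable_EFinP.
  rewrite EFinM lee_wpmul2l ?lee_fin//.
  by apply: integral_expR_abs_comb => //; rewrite mulr_ge0.
by rewrite sumEFin -mulr_suml lee_fin ler_wpM2r.
Qed.

Section EllNorm.
Context {Z : normedModType R} (T : bounded_op (ell2 R) Z).
Let w n := T (ell2_basis n).

(** A sum chosen by [xget] is an L2 limit of partial sums and inherits their bound; if there is
    none, the default is the zero function. *)
Lemma ell_norm_le (C : R) : 0 <= C ->
  (forall n, gauss_norm n w <= C) -> (ell_norm g T <= C%:E)%E.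
Proof.
move=> C0 wC; rewrite /ell_norm; case: xgetP => [S _ [[mS Sf] Scvg]|_]; last first.
  rewrite (@L2norm_sqrt _ _ _ P _ _ 0) ?sqrtr0 ?lee_fin//.
  rewrite (eq_integral (cst 0%E)) ?integral0// => t _.
  by rewrite normr0 expr0n.
apply/lee_addgt0Pr => e e0.
have /fine_cvgP[Sfin /cvgrPdist_lt/(_ _ e0)] := Scvg => Sdist.
have [n [nfin ndist]] := filter_ex (filterI Sfin Sdist).
rewrite sub0r normrN in ndist.
have -> : S = (fun t => gauss_sum n w t + (S t - gauss_sum n w t)).
  by apply/funext => t; rewrite addrC subrK.
apply: le_trans (L2normD _ _ _) _.
- exact: strongly_measurable_gauss_sum.
- by apply: strongly_measurableB => //; exact: strongly_measurable_gauss_sum.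
rewrite leeD//; first by rewrite gauss_normE lee_fin.
rewrite -(fineK nfin) lee_fin (le_trans (ler_norm _))//; exact: ltW.
Qed.

(** The partial sums are stationary from [n] on, so an [L2_sum] exists and the default of [xget] is
    excluded. The chosen one may differ from the finite sum on a null set, hence the comparison
    through L2 distances. *)
Lemma gauss_norm_le_ell_norm n : (forall i, (n <= i)%N -> w i = 0) ->
  ((gauss_norm n w)%:E <= ell_norm g T)%E.
Proof.
move=> w0.
have gauss_sumE N : (n <= N)%N -> gauss_sum N w = gauss_sum n w.
  by move=> nN; apply/funext => t; exact: gauss_sum_widen.
rewrite /ell_norm; case: xgetP => [S _ [[mS Sf] Scvg]|/(_ (gauss_sum n w))[]]; last first.
  split; first by split; [exact: strongly_measurable_gauss_sum|exact: L2norm_gauss_sum_fin].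
  apply: cvg_near_cst; exists n => // N /= /gauss_sumE NE.
  rewrite (@L2norm_sqrt _ _ _ P _ _ 0) ?sqrtr0//.
  rewrite (eq_integral (cst 0%E)) ?integral0// => t _.
  by rewrite -NE subrr normr0 expr0n.
apply/lee_addgt0Pr => e e0.
have /fine_cvgP[Sfin /cvgrPdist_lt/(_ _ e0)] := Scvg => Sdist.
have nN : \forall N \near \oo, (n <= N)%N by exists n.
have [N [/gauss_sumE NE [nfin ndist]]] := filter_ex (filterI nN (filterI Sfin Sdist)).
rewrite sub0r normrN in ndist.
rewrite -gauss_normE -NE.
have -> : gauss_sum N w = (fun t => S t + (-1) *: (S t - gauss_sum N w t)).
  by apply/funext => t; rewrite scaleN1r opprB addrC subrK.
have mD : strongly_measurable (fun t => S t - gauss_sum N w t).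
  by apply: strongly_measurableB => //; exact: strongly_measurable_gauss_sum.
have Df : (L2norm P (fun t => (S t - gauss_sum N w t)%R) < +oo)%E.
  by rewrite -ge0_fin_numE// Lnorm_ge0.
apply: le_trans (L2normD _ _ _) _ => //.
  rewrite (_ : (fun t => _) = (fun t => gauss_sum N w t - S t)); last first.
    by apply/funext => t; rewrite scaleN1r opprB.
  by apply: strongly_measurableB => //; exact: strongly_measurable_gauss_sum.
rewrite leeD2l// L2normZ// normrN1 mul1e.
rewrite -(fineK nfin) lee_fin (le_trans (ler_norm _))//; exact: ltW.
Qed.

End EllNorm.
End GaussianSums.

(** * Operators into l2 *)

Section Ell2Operators.
Context {R : realType}.

Lemma sqr_le_mul (x c : R) : 0 <= x -> 0 <= c -> x ^+ 2 <= c * x -> x <= c.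
Proof.
move=> x0 c0; have [->//|xn0] := eqVneq x 0.
by rewrite expr2 ler_pM2r// lt_def xn0.
Qed.

Lemma cauchy_schwarz_ord n (a b : 'I_n -> R) :
  `|\sum_i a i * b i| <= Num.sqrt (\sum_i a i ^+ 2) * Num.sqrt (\sum_i b i ^+ 2).
Proof.
have A0 : 0 <= \sum_i a i ^+ 2 by apply: sumr_ge0 => i _; exact: sqr_ge0.
have B0 : 0 <= \sum_i b i ^+ 2 by apply: sumr_ge0 => i _; exact: sqr_ge0.
rewrite -sqrtrM// -sqrtr_sqr ler_wsqrtr//.
set A := \sum_i a i ^+ 2 in A0 *; set B := \sum_i b i ^+ 2 in B0 *; set S := \sum_i _.
have h t : 0 <= A - 2 * t * S + t ^+ 2 * B.
  have -> : A - 2 * t * S + t ^+ 2 * B = \sum_i (a i - t * b i) ^+ 2.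
    rewrite /A /B /S !mulr_sumr -sumrB -big_split /=.
    by apply: eq_bigr => i _; ring.
  by apply: sumr_ge0 => i _; exact: sqr_ge0.
have [Bz|Bn0] := eqVneq B 0.
  have b0 i : b i = 0.
    apply/eqP; rewrite -sqrf_eq0; apply/eqP; move/eqP: Bz.
    rewrite psumr_eq0; last by move=> j _; exact: sqr_ge0.
    by move=> /allP/(_ i); rewrite mem_index_enum => /(_ isT)/eqP.
  rewrite /S big1 ?expr0n ?mulr_ge0// => i _; by rewrite b0 mulr0.
have Bp : 0 < B by rewrite lt_def Bn0.
have := h (S / B).
rewrite [X in 0 <= X](_ : _ = (A * B - S ^+ 2) / B); last by field.
by rewrite pmulr_lge0 ?invr_gt0// subr_ge0.
Qed.

Lemma ell2_norm_le (u : ell2 R) (c : R) : 0 <= c ->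
  (forall n, \sum_(i < n) u i ^+ 2 <= c ^+ 2) -> `|u| <= c.
Proof.
move=> c0 uc; rewrite -[ `|u| ]/(ell2_norm u) /ell2_norm -(ger0_norm c0) -sqrtr_sqr.
apply: ler_wsqrtr; apply: limr_le; first exact: ell2_is_cvg.
by apply: nearW => n; rewrite /series/= big_mkord.
Qed.

Lemma ell2_sum_le (u : ell2 R) n : Num.sqrt (\sum_(i < n) u i ^+ 2) <= `|u|.
Proof.
rewrite -[ `|u| ]/(ell2_norm u) /ell2_norm; apply: ler_wsqrtr.
by have := ell2_sqnorm_ge u n; rewrite /series/= big_mkord.
Qed.

Lemma ell2_sumE I (r : seq I) (P : pred I) (F : I -> ell2 R) k :
  (\sum_(i <- r | P i) F i) k = \sum_(i <- r | P i) F i k.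
Proof.
have ev : {morph (fun u : ell2 R => u k) : u v / u + v} by [].
exact: (big_morph _ ev (erefl : (0 : ell2 R) k = 0)).
Qed.

Definition ell2_fin n (y : nat -> R) : ell2 R := \sum_(i < n) y i *: ell2_basis i.

Lemma ell2_finE n y k : ell2_fin n y k = if (k < n)%N then y k else 0.
Proof.
rewrite ell2_sumE (eq_bigr (fun i : 'I_n => y i * (k == i)%:R))//.
case: ifPn => kn.
  rewrite (bigD1 (Ordinal kn))//= eqxx mulr1 big1 ?addr0// => i.
  by rewrite -val_eqE /= eq_sym => /negPf ->; rewrite mulr0.
rewrite big1// => i _; case: eqP => [ki|]; last by rewrite mulr0.
by move: kn; rewrite ki ltn_ord.
Qed.

Lemma ell2_fin_norm n y : `|ell2_fin n y| <= Num.sqrt (\sum_(i < n) y i ^+ 2).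
Proof.
have S0 : 0 <= \sum_(i < n) y i ^+ 2 by apply: sumr_ge0 => i _; exact: sqr_ge0.
apply: ell2_norm_le => [|N]; first exact: sqrtr_ge0.
rewrite sqr_sqrtr//; under eq_bigr => i _ do rewrite ell2_finE.
have [nN|/ltnW Nn] := leqP n N.
  rewrite [leRHS](big_ord_widen _ (fun i => y i ^+ 2) nN) [leRHS]big_mkcond /=.
  by apply: ler_sum => i _; case: ifP => // _; rewrite expr0n.
rewrite [leLHS](big_ord_widen _ (fun i => (if (i < n)%N then y i else 0) ^+ 2) Nn).
rewrite [leLHS]big_mkcond /=; apply: ler_sum => i _; rewrite ltn_ord.
by case: ifP => // _; exact: sqr_ge0.
Qed.

Lemma bounded_op_ell2 (V : normedModType R) (f : nat -> dual V) (M : R) :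
  0 <= M ->
  (forall v n, \sum_(i < n) f i v ^+ 2 <= (M * `|v|) ^+ 2) ->
  exists T : bounded_op V (ell2 R), forall v i, T v i = f i v.
Proof.
move=> M0 fM.
have sq v : (fun i => (f i v : R)) \in square_summable.
  apply/square_summableP; apply: nondecreasing_is_cvgn; first exact: series_sqr_nd.
  by exists ((M * `|v|) ^+ 2) => _ [n _ <-]; rewrite /series/= big_mkord.
pose F v := Ell2 (sq v).
have lF : linear F by move=> a v w; apply/val_inj/funext => i /=; rewrite linearP.
have FM v : `|F v| <= M * `|v|.
  by apply: ell2_norm_le => [|n]; [rewrite mulr_ge0|exact: fM].
by have [T TF] := bounded_op_of lF FM; exists T => v i; rewrite TF.
Qed.

Lemma coord_functional (V : normedModType R) (T : bounded_op V (ell2 R)) :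
  exists f : nat -> dual V, forall i v, f i v = T v i.
Proof.
suff H i : exists f : dual V, forall v, f v = T v i.
  by have [f Hf] := choice H; exists f.
apply: (@bounded_op_of _ V R^o (fun v => T v i) (opnorm T)).
  by move=> a v w; rewrite linearP.
move=> v; apply: le_trans (ler_opnorm T v).
rewrite -[leRHS]/(ell2_norm (T v)) -[leLHS]sqrtr_sqr; apply: ler_wsqrtr.
exact: ell2_coord_le.
Qed.

(** When the [f i] are the coordinate functionals of an operator into l2, this is its adjoint cut
    off after [n] coordinates; its finite rank lets [GAP] apply. *)
Lemma truncated_op (V : normedModType R) (f : nat -> dual V) n :
  exists S : bounded_op (ell2 R) (dual V), forall u, S u = \sum_(i < n) u i *: f i.
Proof.
apply: (@bounded_op_of _ (ell2 R) (dual V) _ (\sum_(i < n) `|f i|)).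
  move=> a u v; rewrite scaler_sumr -big_split; apply: eq_bigr => i _ /=.
  by rewrite scalerA -scalerDl.
move=> u; apply: (le_trans (ler_norm_sum _ _ _)); rewrite mulr_suml.
apply: ler_sum => i _; rewrite normrZ mulrC ler_wpM2l//.
rewrite -[leRHS]/(ell2_norm u) -[leLHS]sqrtr_sqr; apply: ler_wsqrtr.
exact: ell2_coord_le.
Qed.

End Ell2Operators.

Section Pi1.
Context {R : realType} {V W : normedModType R}.
Variable T : bounded_op V W.

Lemma pi1_ge0 : (0 <= pi1 T)%E.
Proof. by apply: le_ereal_inf_tmp => _ [C [C0 _] <-]; rewrite lee_fin. Qed.

Lemma pi1_le C : summing_bound T C -> (pi1 T <= C%:E)%E.
Proof. by move=> TC; apply: ereal_inf_lbound; exists C. Qed.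

(** Each defining inequality is closed in [C], so the infimum satisfies it. *)
Lemma pi1_attained : one_summing T -> exists2 C, pi1 T = C%:E & summing_bound T C.
Proof.
move=> [C0 TC0].
have pf : pi1 T \is a fin_num.
  by rewrite ge0_fin_numE ?pi1_ge0// (le_lt_trans (pi1_le TC0))// ltry.
exists (fine (pi1 T)); first by rewrite fineK.
split; first by rewrite fine_ge0// pi1_ge0.
move=> n x; apply/ler_addgt0Pr => e e0.
have w0 := weak_l1_ge0 x.
pose d := e / (weak_l1 x + 1).
have d0 : 0 < d by rewrite divr_gt0// ltr_wpDl.
have [_ [C TC <-] Cd] := lb_ereal_inf_adherent d0 pf.
rewrite -/(pi1 T) -(fineK pf) -EFinD lte_fin in Cd.
apply: (le_trans (TC.2 _ _)).
apply: (@le_trans _ _ ((fine (pi1 T) + d) * weak_l1 x)).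
  by rewrite ler_wpM2r// ltW.
rewrite mulrDl lerD2l /d mulrAC ler_pdivrMr ?ltr_wpDl//.
by rewrite ler_pM2l// lerDl.
Qed.

Lemma pi1_pinfty : ~ one_summing T -> pi1 T = +oo%E.
Proof.
move=> nT; rewrite /pi1 (_ : [set _ | _ in _] = set0) ?ereal_inf0//.
by apply/seteqP; split=> // x [C TC _]; apply: nT; exists C.
Qed.

End Pi1.

(** * The Gaussian average property for duals *)

Section GapBound.
Context {R : realType} d {Omega : measurableType d} (P : probability Omega R).
Variable g : nat -> {RV P >-> R}.
Hypothesis hg : gaussian_sequence g.

(** The form in which [GAP] enters both implications. The truncations satisfy [|S u v| <= |u| |T v|]
    by Cauchy-Schwarz, so [summing_bound_adjoint] bounds their adjoints by the summing constant of
    [T]. *)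
Lemma GAP_gauss_norm (V : normedModType R) : GAP g (dual V) ->
  exists2 K : R, 0 <= K & forall (T : bounded_op V (ell2 R)) (f : nat -> dual V) C,
    (forall i v, f i v = T v i) -> summing_bound T C ->
    forall n, gauss_norm g n f <= K * C.
Proof.
move=> [K HK]; exists `|K| => // T f C fT TC n.
have [S SE] := truncated_op f n.
have frS : finite_rank S.
  by exists n, (fun i => f i) => u; exists (fun i => u i).
have Sb i : S (ell2_basis i) = if (i < n)%N then f i else 0.
  rewrite SE; case: ifPn => [ilt|nlt].
    rewrite (bigD1 (Ordinal ilt))//= eqxx scale1r big1 ?addr0// => j.
    by rewrite -val_eqE /= => /negPf ->; rewrite scale0r.
  rewrite big1// => j _ /=; case: eqP => [ji|_]; last by rewrite scale0r.
  by move: nlt; rewrite -ji ltn_ord.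
have S0 i : (n <= i)%N -> S (ell2_basis i) = 0.
  by move=> ni; rewrite Sb ltnNge ni.
have SC : summing_bound (adjoint S) C.
  apply: summing_bound_adjoint TC => u v.
  rewrite SE.
  have -> : (\sum_(i < n) u i *: f i) v = \sum_(i < n) u i * T v i.
    have ev : {morph (fun F : dual V => F v) : F G / F + G} by [].
    rewrite (big_morph _ ev (erefl : (0 : dual V) v = 0)).
    by apply: eq_bigr => i _; rewrite -fT.
  apply: (le_trans (cauchy_schwarz_ord _ _)).
  by apply: ler_pM; rewrite ?sqrtr_ge0//; exact: ell2_sum_le.
have := gauss_norm_le_ell_norm hg S0.
rewrite (eq_gauss_norm g (w' := f)); last by move=> i ilt; rewrite Sb ilt.
rewrite -lee_fin => /le_trans; apply; apply: (le_trans (HK S frS)).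
rewrite EFinM; apply: (@le_trans _ _ (`|K|%:E * pi1 (adjoint S))%E).
  by rewrite lee_wpmul2r ?pi1_ge0// lee_fin ler_norm.
by rewrite lee_wpmul2l ?lee_fin//; exact: pi1_le.
Qed.

End GapBound.

(** * Extension of operators *)

Section FinSeq.
Context {R : realType} {V : lmodType R}.

Definition finitely_supported : {pred nat -> V} :=
  mem [set w : nat -> V | exists n, forall i, (n <= i)%N -> w i = 0].
Definition finitely_supported_key : pred_key finitely_supported. Proof. exact. Qed.
Canonical finitely_supported_keyed := KeyedPred finitely_supported_key.

Lemma finitely_supportedP (w : nat -> V) :
  w \in finitely_supported <-> exists n, forall i, (n <= i)%N -> w i = 0.
Proof. by split; rewrite ?inE. Qed.

Lemma finitely_supported_submod_closed : submod_closed finitely_supported.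
Proof.
split=> [|a u v]; first by apply/finitely_supportedP; exists 0%N.
move=> /finitely_supportedP[n un] /finitely_supportedP[m vm].
apply/finitely_supportedP; exists (maxn n m) => i; rewrite geq_max => /andP[ni mi].
by rewrite -[LHS]/(a *: u i + v i) un// vm// scaler0 addr0.
Qed.

HB.instance Definition _ :=
  GRing.isSubmodClosed.Build _ _ finitely_supported finitely_supported_submod_closed.

(** A linear space that holds families of every length, so that one extension determines all [phi i]
    at once. *)
Record fin_seq : Type := FinSeq {
  fin_seq_fun :> nat -> V;
  fin_seq_supp : fin_seq_fun \in finitely_supported }.

HB.instance Definition _ := [isSub for fin_seq_fun].
HB.instance Definition _ := gen_eqMixin fin_seq.
HB.instance Definition _ := gen_choiceMixin fin_seq.
HB.instance Definition _ := [SubChoice_isSubLmodule of fin_seq by <:].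

Lemma fin_seq_bound (w : fin_seq) : exists n, forall i, (n <= i)%N -> w i = 0.
Proof. exact/finitely_supportedP/fin_seq_supp. Qed.

(** An arbitrary bound for the support, not the least one; quantities defined through it have to be
    shown independent of the choice. *)
Definition fin_seq_size (w : fin_seq) : nat := projT1 (cid (fin_seq_bound w)).

Lemma fin_seq_sizeP (w : fin_seq) i : (fin_seq_size w <= i)%N -> w i = 0.
Proof. exact: (projT2 (cid (fin_seq_bound w))). Qed.

Lemma fin_seq_of (v : nat -> V) n : exists w : fin_seq,
  forall i, w i = if (i < n)%N then v i else 0.
Proof.
have fw : (fun i => if (i < n)%N then v i else 0) \in finitely_supported.
  by apply/finitely_supportedP; exists n => i ni; rewrite ltnNge ni.
by exists (FinSeq fw).
Qed.

Lemma fin_seq_ext (u v : fin_seq) : (forall i, u i = v i) -> u = v.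
Proof. by move=> uv; apply/val_inj/funext. Qed.

Lemma fin_seq_sumE I (r : seq I) (P : pred I) (F : I -> fin_seq) k :
  (\sum_(i <- r | P i) F i) k = \sum_(i <- r | P i) F i k.
Proof.
have ev : {morph (fun u : fin_seq => u k) : u v / u + v} by [].
exact: (big_morph _ ev (erefl : (0 : fin_seq) k = 0)).
Qed.

End FinSeq.
Arguments fin_seq {R} V.

Section Extension.
Context {R : realType} d {Omega : measurableType d} (P : probability Omega R).
Variable g : nat -> {RV P >-> R}.
Hypothesis hg : gaussian_sequence g.
Context {X : normedModType R} (E : closed_subspace X).

Local Notation gauss_norm := (gauss_norm g).

(** The [phi i] are the restrictions of one extended functional to the single slots of a sequence.
    Their boundedness is deduced only later, so they are plain functions here. *)
Lemma extend_sequence (f : nat -> dual (subspace_type E)) (D : R) :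
  0 <= D -> (forall n, gauss_norm n f <= D) ->
  exists phi : nat -> X -> R,
    [/\ forall i a x y, phi i (a *: x + y) = a * phi i x + phi i y,
        forall i (x : subspace_type E), phi i (x : X) = f i x &
        forall n (w : nat -> X),
          gauss_var g * \sum_(i < n) phi i (w i) <= D * gauss_norm n w].
Proof.
move=> D0 fD; pose k := gauss_var g.
have k0 : 0 < k by exact: gauss_var_gt0.
have normE (Z : normedModType R) (w : fin_seq Z) n :
    (forall i, (n <= i)%N -> w i = 0) -> gauss_norm (fin_seq_size w) w = gauss_norm n w.
  move=> wn; have ws := @fin_seq_sizeP _ _ w.
  have [le|/ltnW le] := leqP n (fin_seq_size w); first exact: gauss_norm_widen.
  exact/esym/gauss_norm_widen.
(* The factor [D / k] is what [gauss_sum_duality] yields for sequences in [E]. *)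
pose p (w : fin_seq X) : R := D / k * gauss_norm (fin_seq_size w) w.
pose inc0 (u : fin_seq (subspace_type E)) i : X := u i.
have incP u : inc0 u \in finitely_supported.
  apply/finitely_supportedP; have [n un] := fin_seq_bound u.
  by exists n => i /un ui; rewrite /inc0 ui.
pose inc u := FinSeq (incP u).
pose psi (u : fin_seq (subspace_type E)) : R := \sum_(i < fin_seq_size u) f i (u i).
have psiE (u : fin_seq (subspace_type E)) n :
    (forall i, (n <= i)%N -> u i = 0) -> psi u = \sum_(i < n) f i (u i).
  move=> un; have us := @fin_seq_sizeP _ _ u.
  have widen a b : (a <= b)%N -> (forall i, (a <= i)%N -> u i = 0) ->
      \sum_(i < b) f i (u i) = \sum_(i < a) (f i (u i) : R).
    move=> ab ua; rewrite (big_ord_widen _ (fun i => f i (u i) : R) ab).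
    rewrite [LHS](bigID (fun i : 'I_b => (i < a)%N)) /=.
    by rewrite [X in _ + X]big1 ?addr0// => i; rewrite -leqNgt => /ua ->; rewrite linear0.
  have [le|/ltnW le] := leqP n (fin_seq_size u); first exact: widen.
  exact/esym/widen.
have DK0 : 0 <= D / k by rewrite divr_ge0// ltW.
have [||||| F [Fp Fi]] := @hahn_banach R (fin_seq X) p _ _ (fin_seq (subspace_type E)) inc psi.
- move=> u v; rewrite -mulrDr ler_wpM2l//.
  pose n := maxn (fin_seq_size u) (fin_seq_size v).
  have un i : (n <= i)%N -> u i = 0.
    by rewrite geq_max => /andP[? _]; exact: fin_seq_sizeP.
  have vn i : (n <= i)%N -> v i = 0.
    by rewrite geq_max => /andP[_ ?]; exact: fin_seq_sizeP.
  rewrite (normE _ u n un) (normE _ v n vn) (normE _ (u + v) n).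
    exact: gauss_normD.
  by move=> i ni; rewrite -[LHS]/(u i + v i) un// vn// addr0.
- move=> a u a0; rewrite /p (normE _ (a *: u) (fin_seq_size u)).
    by rewrite (gauss_normZ hg _ a u) ger0_norm// mulrCA.
  by move=> i ni; rewrite -[LHS]/(a *: u i) fin_seq_sizeP// scaler0.
- by move=> a u v; apply: fin_seq_ext => i.
- move=> a u v.
  pose n := maxn (fin_seq_size u) (fin_seq_size v).
  have un i : (n <= i)%N -> u i = 0.
    by rewrite geq_max => /andP[? _]; exact: fin_seq_sizeP.
  have vn i : (n <= i)%N -> v i = 0.
    by rewrite geq_max => /andP[_ ?]; exact: fin_seq_sizeP.
  rewrite (psiE u n un) (psiE v n vn) (psiE (a *: u + v) n); last first.
    by move=> i ni; rewrite -[LHS]/(a *: u i + v i) un// vn// scaler0 addr0.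
  rewrite mulr_sumr -big_split; apply: eq_bigr => i _ /=.
  by rewrite linearP.
- move=> u; pose n := fin_seq_size u.
  have incn i : (n <= i)%N -> inc u i = 0.
    by move=> /fin_seq_sizeP ui; rewrite -[LHS]/(u i : X) ui.
  rewrite /p (normE _ (inc u) n incn) mulrAC ler_pdivlMr// mulrC.
  apply: (le_trans (gauss_sum_duality hg n f u)).
  apply: ler_pM; rewrite ?gauss_norm_ge0//.
  (* [E] carries the norm of [X], so the two Gaussian sums have the same norm at every [t]. *)
  apply: (gauss_norm_le hg) => t.
  rewrite -[leLHS]/(`|(gauss_sum g n u t : X)|) /gauss_sum.
  have ev : {morph (fun x : subspace_type E => (x : X)) : x y / x + y} by [].
  by rewrite (big_morph _ ev erefl).
have dlP (i : nat) (x : X) : exists w : fin_seq X, forall j, w j = if j == i then x else 0.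
  have [w wE] := fin_seq_of (fun j : nat => if j == i then x else 0) i.+1.
  exists w => j; rewrite wE; case: ifP => // ji; case: eqP => // e.
  by move: ji; rewrite e ltnSn.
pose dl (i : nat) (x : X) : fin_seq X := projT1 (cid (dlP i x)).
have dlE i x j : dl i x j = if j == i then x else 0 := projT2 (cid (dlP i x)) j.
have dlL i a x y : dl i (a *: x + y) = a *: dl i x + dl i y.
  apply: fin_seq_ext => j; rewrite -[RHS]/(a *: dl i x j + dl i y j) !dlE.
  by case: ifP => // _; rewrite scaler0 addr0.
exists (fun i x => F (dl i x)); split.
- by move=> i a x y; rewrite dlL linearP.
- move=> i x.
  have [u uE] := fin_seq_of (fun j : nat => if j == i then x else 0) i.+1.
  have uE' (j : nat) : u j = if j == i then x else 0.
    rewrite uE; case: ifP => // ji; case: eqP => // e.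
    by move: ji; rewrite e ltnSn.
  have -> : dl i x = inc u.
    apply: fin_seq_ext => j; rewrite dlE -[RHS]/(u j : X) uE'.
    by case: ifP.
  rewrite Fi (psiE u i.+1) => [|j ij]; last by rewrite uE' gtn_eqF.
  rewrite big_ord_recr /= big1 ?add0r; last first.
    by move=> j _; rewrite uE' ltn_eqF// linear0.
  by rewrite uE' eqxx.
- move=> n w; pose v : fin_seq X := \sum_(i < n) dl i (w i).
  have vE j : v j = if (j < n)%N then w j else 0.
    rewrite fin_seq_sumE; case: ifPn => jn.
      rewrite (bigD1 (Ordinal jn))//= dlE eqxx big1 ?addr0// => i.
      by rewrite -val_eqE /= dlE eq_sym => /negPf ->.
    rewrite big1// => i _; rewrite dlE; case: eqP => // ji.
    by move: jn; rewrite ji ltn_ord.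
  have := Fp v; rewrite /p (normE _ v n); last by move=> j nj; rewrite vE ltnNge nj.
  rewrite (eq_gauss_norm g (w' := w)); last by move=> j jn; rewrite vE jn.
  by rewrite mulrAC ler_pdivlMr// mulrC /v linear_sum.
Qed.

Lemma GAP_summing_extension :
  finite_cotype X -> GAP g (dual (subspace_type E)) -> summing_extension E.
Proof.
move=> /(gauss_norm_comb_le hg)[C C0 HC] /(GAP_gauss_norm hg)[K K0 HK].
pose k := gauss_var g.
have k0 : 0 < k by exact: gauss_var_gt0.
(* [K] comes from [GAP], [C] from finite cotype, and [k] is the second moment that appears in the
   duality. *)
exists (K * C / k); split; first by rewrite divr_ge0 ?mulr_ge0// ltW.
move=> T /pi1_attained[p1 Tp1 Tb].
have p10 : 0 <= p1 by exact: Tb.1.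
have [f fT] := coord_functional T.
have Kp0 : 0 <= K * p1 by exact: mulr_ge0.
have [phi [phiL phif phiD]] := extend_sequence Kp0 (HK T f p1 fT Tb).
pose M := K * C / k * p1.
have M0 : 0 <= M by rewrite mulr_ge0// divr_ge0 ?mulr_ge0// ltW.
have phi_sum i (I : finType) (a : I -> R) (x : I -> X) :
    phi i (\sum_j a j *: x j) = \sum_j a j * phi i (x j).
  have phi0 : phi i 0 = 0.
    by have := phiL i (-1) 0 0; rewrite scaleN1r oppr0 addr0 mulN1r addNr.
  have phiA u v : phi i (u + v) = phi i u + phi i v.
    by rewrite -{1}[u]scale1r phiL mul1r.
  elim/big_ind2: _ => //; last first.
    by move=> j _; rewrite -[_ *: _]addr0 phiL phi0 addr0.
  move=> ? ? ? ? <- <-; exact: phiA.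
(* A positive [t] is used because the family is rescaled by its inverse and the weak l1-norm itself
   may vanish. *)
have dom m (x : 'I_m -> X) t n (a : 'I_m -> nat -> R) : 0 < t -> weak_l1 x <= t ->
    (forall j, \sum_(i < n) a j i ^+ 2 <= 1) ->
    \sum_j \sum_(i < n) a j i * phi i (x j) <= M * t.
  move=> t0 xt a1.
  pose y j := t^-1 *: x j.
  have y1 : weak_l1 y <= 1.
    apply: weak_l1_le => F F1.
    under eq_bigr => j _ do rewrite linearZ normrM gtr0_norm ?invr_gt0//.
    rewrite -mulr_sumr mulrC ler_pdivrMr// mul1r.
    by apply: le_trans xt; exact: weak_l1_ub.
  have := phiD n (fun i => \sum_j a j i *: y j).
  have -> : \sum_(i < n) phi i (\sum_j a j i *: y j) =
      t^-1 * \sum_j \sum_(i < n) a j i * phi i (x j).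
    under eq_bigr => i _ do rewrite phi_sum.
    rewrite exchange_big mulr_sumr; apply: eq_bigr => j _ /=.
    rewrite mulr_sumr; apply: eq_bigr => i _.
    rewrite (_ : phi i (y j) = t^-1 * phi i (x j)); first by rewrite mulrCA.
    have := phi_sum i 'I_1 (fun=> t^-1) (fun=> x j).
    by rewrite !big_ord1.
  have := HC m y y1 n a a1; rewrite -/k.
  set S := \sum_j _; set G := gauss_norm n _ => GC le1.
  have : k * (t^-1 * S) <= K * p1 * C by apply: (le_trans le1); rewrite ler_wpM2l.
  rewrite mulrCA mulrC ler_pdivrMr// => le2.
  rewrite -(ler_pM2l k0); apply: (le_trans le2).
  by rewrite /M le_eqVlt; apply/orP; left; apply/eqP; field; rewrite gt_eqF.
pose r n x := Num.sqrt (\sum_(i < n) phi i x ^+ 2).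
have r0 n x : 0 <= r n x by exact: sqrtr_ge0.
have rsum m (x : 'I_m -> X) t n : 0 < t -> weak_l1 x <= t -> \sum_j r n (x j) <= M * t.
  (* The optimal coefficients form the normalised vector of the [phi i (x j)]. If that vector is
     zero, division by zero gives the zero vector, which is admissible as well. *)
  move=> t0 xt; pose a j i := phi i (x j) / r n (x j).
  have rE j : r n (x j) ^+ 2 = \sum_(i < n) phi i (x j) ^+ 2.
    by rewrite sqr_sqrtr// sumr_ge0// => i _; exact: sqr_ge0.
  apply: le_trans (dom m x t n a t0 xt _) => [|j].
    apply: ler_sum => j _; rewrite /a.
    have [->|rn0] := eqVneq (r n (x j)) 0.
      by rewrite big1// => i _; rewrite invr0 mulr0 mul0r.
    under eq_bigr => i _ do rewrite mulrAC -expr2.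
    by rewrite -mulr_suml -rE expr2 mulfK.
  rewrite /a; under eq_bigr => i _ do rewrite exprMn.
  rewrite -mulr_suml -rE exprVn.
  have [->|rn0] := eqVneq (r n (x j)) 0; first by rewrite expr0n mul0r.
  by rewrite mulfV// expf_neq0.
(* One-vector families give the pointwise bound that makes each [phi i], and then [T'], bounded. *)
have rx n x : r n x <= M * `|x|.
  apply/ler_addgt0Pr => e e0.
  pose s := e / (M + 1).
  have s0 : 0 < s by rewrite divr_gt0// ltr_wpDl.
  have xs0 : 0 < `|x| + s by rewrite ltr_wpDl.
  have w1 : weak_l1 (fun _ : 'I_1 => x) <= `|x| + s.
    apply: weak_l1_le => F F1; rewrite big_ord1.
    apply: (le_trans (ler_opnorm F x)).
    by apply: (@le_trans _ _ `|x|); [rewrite ler_piMl|rewrite lerDl ltW].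
  have := rsum 1%N (fun=> x) _ n xs0 w1; rewrite big_ord1 => /le_trans; apply.
  rewrite mulrDr lerD2l /s mulrCA ler_piMr ?(ltW e0)// ler_pdivrMr ?ltr_wpDl//.
  by rewrite mul1r lerDl.
have phi_op i : exists F : dual X, forall x, F x = phi i x.
  apply: (@bounded_op_of _ X R^o (phi i) M); first by move=> a x y; exact: phiL.
  move=> x; apply: le_trans (rx i.+1 x); rewrite -[leLHS]sqrtr_sqr ler_wsqrtr//.
  by rewrite big_ord_recr lerDr sumr_ge0// => j _; exact: sqr_ge0.
have [F FE] := choice phi_op.
have [|T' T'E] := @bounded_op_ell2 _ X F M M0.
  move=> x n; under eq_bigr => i _ do rewrite FE.
  rewrite -[leLHS]sqr_sqrtr; last by apply: sumr_ge0 => i _; exact: sqr_ge0.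
  by rewrite lerXn2r ?nnegrE ?sqrtr_ge0 ?(mulr_ge0 M0 (normr_ge0 x))//; exact: rx.
have T'b : summing_bound T' M.
  split=> // m x.
  have T'r j : (fun n => r n (x j)) @ \oo --> `|T' (x j)|.
    rewrite -[ `|_| ]/(ell2_norm (T' (x j))) /ell2_norm.
    rewrite (_ : (fun n => r n (x j)) = Num.sqrt \o series (fun i => T' (x j) i ^+ 2)).
      apply: continuous_cvg; first exact: sqrt_continuous.
      exact: ell2_is_cvg.
    apply/funext => n; rewrite /r /series /= big_mkord; congr Num.sqrt.
    by apply: eq_bigr => i _; rewrite T'E FE.
  have cvgS : (fun n => \sum_j r n (x j)) @ \oo --> \sum_j `|T' (x j)|.
  apply: cvg_big => [|j _]; [exact: add_continuous|exact: T'r].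
  apply/ler_addgt0Pr => e e0.
  pose s := e / (M + 1).
  have s0 : 0 < s by rewrite divr_gt0// ltr_wpDl.
  have ws0 : 0 < weak_l1 x + s by rewrite ltr_wpDl// weak_l1_ge0.
  rewrite -(cvg_lim _ cvgS)//; apply: limr_le; first by apply/cvg_ex; eexists; exact: cvgS.
  apply: nearW => n; apply: (le_trans (rsum _ _ _ _ ws0 _)).
    by rewrite lerDl ltW.
  rewrite mulrDr lerD2l /s mulrCA ler_piMr ?(ltW e0)// ler_pdivrMr ?ltr_wpDl//.
  by rewrite mul1r lerDl.
exists T'; split.
- by exists M.
- by move=> x; apply/val_inj/funext => i /=; rewrite T'E FE phif fT.
- by rewrite Tp1 -EFinM; exact: pi1_le.
Qed.

Lemma summing_extension_GAP :
  GAP g (dual X) -> summing_extension E -> GAP g (dual (subspace_type E)).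
Proof.
move=> /(GAP_gauss_norm hg)[K1 K10 HK] [K2 [K20 HE]].
(* The added 1 keeps the constant positive, so that an infinite [pi1] makes the right-hand side
   infinite; zero times infinity would be 0. *)
exists (K1 * K2 + 1) => T _.
have K0 : 0 < K1 * K2 + 1 by rewrite ltr_wpDl// mulr_ge0.
have [T1|nT] := pselect (one_summing (adjoint T)); last first.
  by rewrite (pi1_pinfty nT) mulry gtr0_sg// mul1e leey.
have [C -> TC] := pi1_attained T1.
have C0 : 0 <= C by exact: TC.1.
pose f i := T (ell2_basis i).
have f_sum y n x : T (ell2_fin n y) x = \sum_(i < n) y i * f i x.
  rewrite linear_sum.
  have ev : {morph (fun F : dual (subspace_type E) => F x) : F G / F + G} by [].
  rewrite (big_morph _ ev (erefl : (0 : dual _) x = 0)).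
  by apply: eq_bigr => i _; rewrite linearZ.
(* Duality in l2: testing [T] on the truncated vector with coordinates [f i x] bounds the sum [S] of
   their squares by [B] times its square root. *)
have fsq x n B : 0 <= B ->
    (forall u : ell2 R, `|T u x| <= B * `|u|) -> \sum_(i < n) f i x ^+ 2 <= B ^+ 2.
  move=> B0 TB; set S := \sum_(i < n) _.
  have S0 : 0 <= S by apply: sumr_ge0 => i _; exact: sqr_ge0.
  rewrite -(sqr_sqrtr S0) lerXn2r ?nnegrE ?sqrtr_ge0//.
  apply: sqr_le_mul; rewrite ?sqrtr_ge0// sqr_sqrtr//.
  have := TB (ell2_fin n (fun i => f i x)); rewrite f_sum.
  rewrite (eq_bigr (fun i : 'I_n => f i x ^+ 2)); last by move=> i _; rewrite expr2.
  rewrite -/S ger0_norm// => /le_trans; apply; rewrite ler_wpM2l//.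
  exact: ell2_fin_norm.
have [Ts TsE] : exists Ts : bounded_op (subspace_type E) (ell2 R), forall x i, Ts x i = f i x.
  apply: (@bounded_op_ell2 _ _ f (opnorm T)); first exact: opnorm_ge0.
  move=> x n; apply: fsq => [|u]; first by rewrite mulr_ge0// opnorm_ge0.
  apply: (le_trans (ler_opnorm (T u) x)).
  by rewrite mulrAC ler_wpM2r//; exact: (ler_opnorm T u).
have [J JE] : exists J : bounded_op (subspace_type E) (dual (dual (subspace_type E))),
    forall x F, J x F = F x.
  have JP x : exists j : dual (dual (subspace_type E)), forall F, j F = F x.
    apply: (@bounded_op_of _ _ R^o (fun F : dual (subspace_type E) => F x) `|x|).
      by [].
    by move=> F; rewrite mulrC; exact: (ler_opnorm F x).
  have [j jE] := choice JP.
  have [|x|J JE] := @bounded_op_of _ _ _ j 1.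
  - move=> a x y; apply: bop_ext => F.
    by rewrite -[RHS]/(a * j x F + j y F) !jE linearP.
  - rewrite mul1r; apply: opnorm_le => F F1; rewrite jE.
    by apply: (le_trans (ler_opnorm F x)); rewrite ler_piMl.
  - by exists J => x F; rewrite JE jE.
have J1 : opnorm J <= 1.
  apply: opnorm_le => x x1; apply: opnorm_le => F F1; rewrite JE.
  by apply: (le_trans (ler_opnorm F x)); rewrite mulr_ile1 ?opnorm_ge0.
(* [J] is the canonical map into the bidual. The norm of [Ts x] is at most that of
   [adjoint T (J x)], and functionals of norm at most 1 on the bidual pull back along [J] to such
   functionals on [E], so weak l1-norms do not grow. *)
have TsC : summing_bound Ts C.
  split=> // n x.
  apply: (@le_trans _ _ (\sum_(i < n) `|adjoint T (J (x i))|)).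
    apply: ler_sum => i _; apply: ell2_norm_le => // m.
    under eq_bigr => l _ do rewrite TsE.
    apply: fsq => // u; rewrite -JE.
    exact: (ler_opnorm (adjoint T (J (x i))) u).
  apply: (le_trans (TC.2 _ _)); rewrite ler_wpM2l//.
  apply: weak_l1_le => F F1.
  have FJ : `|adjoint J F| <= 1.
    apply: opnorm_le => y y1; apply: (le_trans (ler_opnorm F (J y))).
    rewrite mulr_ile1 ?opnorm_ge0//; apply: (le_trans (ler_opnorm J y)).
    by rewrite mulr_ile1 ?opnorm_ge0.
  exact: (weak_l1_ub x FJ).
have [T' [T'1 T'E T'p]] := HE Ts (ex_intro _ C TsC).
have [C' T'C T'b] := pi1_attained T'1.
have C'le : C' <= K2 * C.
  rewrite -lee_fin -T'C (le_trans T'p)// EFinM lee_wpmul2l ?lee_fin//.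
  exact: pi1_le.
have [phi phiE] := coord_functional T'.
have fphi i (x : subspace_type E) : f i x = phi i (x : X).
  by rewrite phiE T'E TsE.
rewrite -EFinM; apply: (ell_norm_le hg); first by rewrite mulr_ge0// ltW.
move=> n; apply: (@le_trans _ _ (gauss_norm n phi)).
  (* Restricting a functional from [X] to [E] does not increase its norm. *)
  apply: (gauss_norm_le hg) => t; apply: opnorm_le => x x1.
  have evE : {morph (fun F : dual (subspace_type E) => F x) : F G / F + G} by [].
  have evX : {morph (fun F : dual X => F (x : X)) : F G / F + G} by [].
  have -> : gauss_sum g n (fun i => T (ell2_basis i)) t x =
      gauss_sum g n phi t (x : X).
    rewrite /gauss_sum (big_morph _ evE (erefl : (0 : dual _) x = 0)).
    rewrite (big_morph _ evX (erefl : (0 : dual X) (x : X) = 0)).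
    by apply: eq_bigr => i _; rewrite -[LHS]/(g i t * f i x) fphi.
  apply: (le_trans (ler_opnorm (gauss_sum g n phi t) (x : X))).
  by rewrite ler_piMr ?opnorm_ge0.
apply: (le_trans (HK T' phi C' phiE T'b n)).
apply: (@le_trans _ _ (K1 * (K2 * C))); first by rewrite ler_wpM2l.
by rewrite mulrA ler_wpM2r// lerDl.
Qed.

End Extension.

Theorem theorem2p2 (R : realType) (d : measure_display)
    (Omega : measurableType d) (P : probability Omega R)
    (g : nat -> {RV P >-> R}) (hg : gaussian_sequence g)
    (X : completeNormedModType R) (E : closed_subspace X) :
  (finite_cotype X -> GAP g (dual (subspace_type E)) -> summing_extension E) /\
  (GAP g (dual X) -> summing_extension E -> GAP g (dual (subspace_type E))).
Proof.
by split; [exact: GAP_summing_extension|exact: summing_extension_GAP].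
Qed.
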